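(* Let $X(S) \subset \mathbb{C}^{2s}$ be an $s$-dimensional toric variety and let $\{e_1,\dots,e_s\}$ be the canonical basis of $\mathbb{Z}^s$. Then $X(S)$ has isolated singularity at the origin and normalization map $f: \mathbb{C}^s \to X(S)$ if and only if the semigroup $S\subset \mathbb{Z}^s$ is generated (up to isomorphism of semigroups) by a set of the form $$\{e_1,\ \dots,\ e_{s-1},\ \lambda_1e_1+e_s,\ \lambda_2e_2+e_s,\ \dots,\ \lambda_{s-1}e_{s-1}+e_s,\ n e_s,\ m e_s\},$$ where $\lambda_i,n,m$ are positive integers with $1 < n< m$ and $\gcd(n,m)=1$, for $i=1, \dots, s-1$. For $s=2$, the semigroup $S$ is generated by $\{(1,0),(\lambda,1),(0,n),(0,m)\}$ with $\lambda$ a positive integer.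
   Context: $S\subset\mathbb{Z}^s$ denotes a finitely generated semigroup under addition with $0\in S$ and $\mathbb{Z}S=\mathbb{Z}^s$, such that the cone $C(S)=\mathbb{R}_{\ge 0}S$ is strongly convex ($C(S)\cap(-C(S))=\{0\}$) of dimension $s$. The $s$-dimensional affine toric variety is $X(S)=\mathrm{Spec}(\mathbb{C}[S])$, where $\mathbb{C}[S]$ is the ring of Laurent polynomials in $s$ variables whose supports lie in $S$. A choice of generators $\gamma_1,\dots,\gamma_p$ of $S$ embeds $X(S)$ in $\mathbb{C}^p$ as the zero set of $I_S=\langle x^{\alpha_+}-x^{\alpha_-} : \alpha\in \mathrm{Ker}(\pi_S)\rangle$, where $\pi_S:\mathbb{Z}^p\to\mathbb{Z}^s$, $\pi_S(\alpha)=\sum\alpha_i\gamma_i$, and $\alpha_+,\alpha_-$ are the positive and negative parts of $\alpha$; ''$X(S)\subset\mathbb{C}^p$'' refers to such an embedding by $p$ generators (here $p=2s$). The origin is the unique $0$-dimensional torus orbit. ''Isolated singularity at the origin'' means that $0$ is a singular point of $X(S)$ and that $X(S)$ is nonsingular at all other points near $0$. ''Normalization map $f:\mathbb{C}^s\to X(S)$'' means that the normalization of $X(S)$ is smooth, namely $\mathbb{C}^s$. *)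

(* Defs.v *)
From HB Require Import structures.
From mathcomp Require Import all_boot all_order all_algebra.
From mathcomp Require Import boolp classical_sets functions reals.
From mathcomp Require Import complex mpoly.

Set Implicit Arguments.
Unset Strict Implicit.
Unset Printing Implicit Defensive.

Import Order.TTheory GRing.Theory Num.Theory.
Local Open Scope classical_set_scope.
Local Open Scope ring_scope.
Local Open Scope complex_scope.

(* Finite combinations of elements of T with coefficients in P; the empty
   combination is allowed, so 0 always belongs to combinations P T. *)
Definition combinations (A : nzRingType) (V : lmodType A) (P : set A)
    (T : set V) : set V :=
  [set x | exists (k : nat) (a : 'I_k -> A) (v : 'I_k -> V),
    [/\ forall i, P (a i), forall i, T (v i) & x = \sum_(i < k) a i *: v i]].

Definition nonneg (A : numDomainType) : set A := [set a | 0 <= a].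

Definition has_dim (F : fieldType) (n : nat) (W : set 'rV[F]_n) (d : nat) :=
  exists2 V : {vspace 'rV[F]_n}, \dim V = d & forall v, v \in V <-> W v.

(* Semigroups are commutative with 0, written additively, inside Z^s. *)
Section Semigroups.
Context (s : nat).
Implicit Types (S T : set 'rV[int]_s).

Definition semigroup_generated_by (G : set 'rV[int]_s) : set 'rV[int]_s :=
  combinations (@nonneg int) G.

Definition semigroup_isomorphic S T :=
  exists phi : 'rV[int]_s -> 'rV[int]_s,
    set_bij S T phi /\
    (forall x y, S x -> S y -> phi (x + y) = phi x + phi y).

Definition group_generated_by S : set 'rV[int]_s := combinations setT S.

Definition cone (R : realType) S : set 'rV[R]_s :=
  combinations (@nonneg R) [set map_mx intr m | m in S].

Definition strongly_convex (R : realType) (K : set 'rV[R]_s) :=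
  forall x, K x -> K (- x) -> x = 0.

(* The dimension of a cone is that of its linear hull. *)
Definition toric_semigroup (R : realType) S :=
  [/\ group_generated_by S = setT,
      strongly_convex (@cone R S) &
      has_dim (combinations setT (@cone R S)) s].

End Semigroups.

(* X(S) in C^p, for the semigroup S of Z^s generated by g_1, ..., g_p *)
Section Embedding.
Context (R : realType) (s p : nat) (g : 'I_p -> 'rV[int]_s).
Local Notation C := R[i].

Definition pos_part (a : 'rV[int]_p) : 'X_{1..p} :=
  [multinom `|(Num.max (a 0 i) 0)%R|%N | i < p].

Definition neg_part (a : 'rV[int]_p) : 'X_{1..p} := pos_part (- a).

Definition toric_binomials : set {mpoly C[p]} :=
  [set 'X_[pos_part a] - 'X_[neg_part a] |
     a in [set a : 'rV[int]_p | \sum_(i < p) a 0 i *: g i = 0]].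

(* the ideal I_S: {mpoly C[p]}^o is the polynomial ring as a module over
   itself *)
Definition toric_ideal : set {mpoly C[p]} :=
  @combinations {mpoly C[p]} {mpoly C[p]}^o setT toric_binomials.

Definition toric_variety : set 'rV[C]_p :=
  [set P : 'rV[C]_p | forall f, toric_ideal f -> f.@[P 0] = 0].

(* Zariski tangent space, i.e. the kernel of the Jacobian at P of I_S *)
Definition tangent_space (P : 'rV[C]_p) : set 'rV[C]_p :=
  [set v : 'rV[C]_p | forall f, toric_ideal f ->
    \sum_(i < p) (f^`M(i)).@[P 0] * v 0 i = 0].

(* X(S) is irreducible of dimension s *)
Definition nonsingular_at (P : 'rV[C]_p) := has_dim (tangent_space P) s.

Definition isolated_singularity_at_origin :=
  [/\ toric_variety 0, ~ nonsingular_at 0 &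
      exists2 e : R, 0 < e &
        forall P, toric_variety P -> P != 0 ->
          (forall i, `|P 0 i| < e%:C) -> nonsingular_at P].

End Embedding.

(* C[S] is realized inside the field of rational functions C(t_1, ..., t_s). *)
Section Normalization.
Context (R : realType) (s : nat).
Local Notation C := R[i].
Local Notation K := {fraction {mpoly C[s]}}.

Definition const (c : C) : K := tofrac (c%:MP : {mpoly C[s]}).

Definition laurent_monomial (m : 'rV[int]_s) : K :=
  \prod_(i < s) (tofrac ('X_i : {mpoly C[s]}) : K) ^ (m 0 i).

Context (S : set 'rV[int]_s).

Definition semigroup_algebra : set K :=
  [set x | exists (k : nat) (c : 'I_k -> C) (m : 'I_k -> 'rV[int]_s),
    (forall i, S (m i)) /\
    x = \sum_(i < k) const (c i) * laurent_monomial (m i)].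

Definition function_field : set K :=
  [set x | exists a b, [/\ semigroup_algebra a, semigroup_algebra b,
    b != 0 & x = a / b]].

(* integral closure of C[S] in its field of fractions *)
Definition normalized_algebra : set K :=
  [set x | function_field x /\
    exists q : {poly K}, [/\ q \is monic,
      forall i : nat, semigroup_algebra q`_i & root q x]].

(* The polynomial map f = (f_1, ..., f_p) from C^s to C^p is the normalization
   map of X(S): for some C-algebra isomorphism phi from C[t_1, ..., t_s] onto
   the integral closure of C[S] (i.e. C^s is the normalization of X(S)), the
   composition of phi with the comorphism of f is the inclusion of C[S], which
   sends the j-th coordinate function of X(S) to the character of g_j. *)
Definition normalization_map (p : nat) (g : 'I_p -> 'rV[int]_s)
    (f : 'I_p -> {mpoly C[s]}) :=
  exists phi : {rmorphism {mpoly C[s]} -> K},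
    [/\ forall c : C, phi c%:MP = const c,
        set_bij setT normalized_algebra phi &
        forall j, phi (f j) = laurent_monomial (g j)].

End Normalization.

(* canonical basis of Z^s, numbered from 1 to s *)
Definition e_ (s k : nat) : 'rV[int]_s := \row_(j < s) (j.+1 == k)%:R.

Definition normal_form_generators (s : nat) (lambda : nat -> nat) (n m : nat) :
    set 'rV[int]_s :=
  [set e_ s i | i in [set i | (1 <= i < s)%N]] `|`
  [set e_ s i *+ lambda i + e_ s s | i in [set i | (1 <= i < s)%N]] `|`
  [set e_ s s *+ n; e_ s s *+ m].

Arguments normal_form_generators s lambda n m : clear implicits.

Definition vec2 (a b : int) : 'rV[int]_2 := \row_(j < 2) [:: a; b]`_j.

(* Main.v *)
(* Write C[S'] for the normalization of C[S], where S' is the saturation of S. If C[S'] is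
   isomorphic to C[t_1, ..., t_s], the cotangent space at the torus-fixed point shows that S'
   has at most s irreducible elements; they generate S', hence form a basis of Z^s, and in
   these coordinates S' = N^s. Smoothness of X(S) at a point of the i-th coordinate axis says
   that the localization of S along the i-th ray is Z x N^(s-1): the tangent space contains
   independent vectors attached to the ray and to each irreducible element of the
   localization. So S contains U_k + a U_i for all k <> i and generates U_i from its elements
   on the ray. As X(S) is singular at 0, some U_i is missing from S; then two generators lie
   on the i-th ray, one on each other ray, and one is of the form U_i + l_k U_k, l_k > 0, for
   each k <> i. These are 2s generators, so there are no others, and each generator on another
   ray is U_k. Conversely the normal form consists of 2s irreducible elements, so the tangent
   space at 0 is C^(2s), and at other points some localization of S is Z x N^(s-1). *)

Require Import Defs.
From mathcomp Require Import all_boot all_order all_algebra.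
From mathcomp Require Import boolp classical_sets functions reals.
From mathcomp Require Import complex mpoly.
From mathcomp Require Import perm zify ring lra.
Import Order.TTheory GRing.Theory Num.Theory.
Local Open Scope classical_set_scope.
Local Open Scope ring_scope.

Set Implicit Arguments.
Unset Strict Implicit.
Unset Printing Implicit Defensive.

(** * Completely integrally closed rings *)

(** [normalization_map] allows any C-algebra isomorphism [phi], which need not send variables to
    monomials. So S' must be recognized as free indirectly: the total degree, pulled back along
    [phi], is additive on S' and vanishes only at 0, which makes S' pointed and generated by
    irreducible elements. That the integral closure of C[S] is C[S'] rests on almost integrality:
    for x integral there is one D <> 0 with every D x^k in C[S]. Under a monomial order the leading
    exponents are d + k m, and Dickson's lemma extracts a positive multiple of m lying in S. The
    same notion over C[t_1, ..., t_s] shows beforehand that x is a Laurent polynomial. Points and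
    tangent vectors of X(S) are treated as functions on S: a point is a multiplicative map chi, a
    tangent vector a map D with D(u + v) = chi(u) D(v) + chi(v) D(u). Explicit maps D bound the
    tangent space from below; monomial parametrizations compute it exactly. An axis point has
    coordinates 0 or t^d with d > 0, so a small t brings it into the neighbourhood of 0 where
    isolatedness applies. *)

Section CompletelyIntegrallyClosed.
Context (F : fieldType) (s : nat).
Implicit Types (P Q D : {mpoly F[s]}).

Lemma mlead_sub_lt P Q : mlead P = mlead Q -> mleadc P = mleadc Q ->
  P != Q -> (mlead (P - Q) < mlead P)%O.
Proof.
move=> eql eqc neq; rewrite lt_neqAle; apply/andP; split; last first.
  by apply: le_trans (mleadB_le P Q) _; rewrite -eql joinxx.
apply: contra neq => /eqP eqPQ.
by rewrite -subr_eq0 -mleadc_eq0 eqPQ mcoeffB eqc eql subrr.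
Qed.

(* P / Q is almost integral: leading monomials force mlead Q to divide mlead P, and
   subtracting the leading term of the quotient preserves almost integrality. *)
Lemma mpoly_dvd_of_powers P Q D : Q != 0 -> D != 0 ->
  (forall k, exists A, D * P ^+ k = Q ^+ k * A) -> exists A, P = Q * A.
Proof.
move=> Qn0 Dn0; elim/mleadrect: P => P IH divP.
have [->|Pn0] := eqVneq P 0; first by exists 0; rewrite mulr0.
have leQP i : (mlead Q i <= mlead P i)%N.
  rewrite leqNgt; apply/negP => ltPQ.
  (* With this many factors, a deficit of one in the i-th exponent per factor exceeds what the
     leading monomial of [D] can supply. *)
  have [A] := divP (mlead D i).+1.
  have [->|An0] := eqVneq A 0.
    by rewrite mulr0 => /eqP; rewrite mulf_eq0 expf_eq0 (negPf Dn0) (negPf Pn0) andbF.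
  move/(congr1 (@mlead _ _)); rewrite !mleadM ?expf_neq0 // !mleadX //.
  move/(congr1 (fun m : 'X_{1..s} => m i)).
  rewrite !mnmDE !mulmnE => eqi.
  have := leq_mul ltPQ (leqnn (mlead D i).+1).
  move: eqi; move: (mlead P i) (mlead Q i) (mlead D i) (mlead A i) => a b c d.
  lia.
pose M := (mleadc P / mleadc Q) *: 'X_[mlead P - mlead Q].
have cn0 : mleadc P / mleadc Q != 0 by rewrite mulf_neq0 ?invr_eq0 ?mleadc_eq0.
have lM : mlead M = (mlead P - mlead Q)%MM.
  by rewrite mleadZ // mleadXm.
have Mn0 : M != 0 by rewrite -mleadc_eq0 lM mcoeffZ mcoeffX eqxx mulr1.
have lQM : mlead (Q * M) = mlead P.
  by rewrite mleadM // lM addmC submK //; apply/mnm_lepP.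
have [PE|neq] := eqVneq P (Q * M); first by exists M.
have ltP : (mlead (P - Q * M) < mlead P)%O.
  apply: mlead_sub_lt => //.
  rewrite lQM -[in RHS]lQM mleadM // mleadcM lM mcoeffZ mcoeffX eqxx mulr1.
  by rewrite mulrC divfK // mleadc_eq0.
have [k|A PE] := IH _ ltP; last first.
  by exists (A + M); rewrite mulrDr -PE subrK.
have /choice [A AE] := divP.
(* Binomial expansion of (P - Q M)^k: [D * P ^+ i] supplies [Q ^+ i], and the power of Q M supplies
   the remaining [Q ^+ (k - i)]. *)
exists (\sum_(i < k.+1) A i * ((- M) ^+ (k - i)) *+ 'C(k, i)).
rewrite -mulrN addrC exprDn !mulr_sumr; apply: eq_bigr => i _.
rewrite !mulrnAr; congr (_ *+ _).
rewrite exprMn mulrCA AE mulrACA -exprD subnK; last by rewrite -ltnS.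
by rewrite [A i * _]mulrC.
Qed.

End CompletelyIntegrallyClosed.

(** The monic equation rewrites [f ^+ n] through lower powers. Each rewriting costs one factor [T],
    to clear a coefficient of [q], and lowers the exponent by at least one, so [T ^+ k] pays for all
    of them. *)
Lemma almost_integral_powers (K : comNzRingType) (B : set K) (q : {poly K})
    (n : nat) (f T D : K) :
  B 0 -> (forall x y, B x -> B y -> B (x - y)) ->
  (forall x y, B x -> B y -> B (x * y)) ->
  q \is monic -> size q = n.+1 -> root q f ->
  B T -> (forall i, B (T * q`_i)) -> (forall k, (k < n)%N -> B (D * f ^+ k)) ->
  forall k, B (T ^+ k * (D * f ^+ k)).
Proof.
move=> B0 BB BM qmon qsz /rootP qf BT BTq BD.
have BN x : B x -> B (- x) by move=> Bx; rewrite -sub0r; apply: BB.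
have BA x y : B x -> B y -> B (x + y).
  by move=> Bx By; rewrite -[y]opprK; apply: BB => //; apply: BN.
have BX k y : B y -> B (T ^+ k * y).
  by elim: k y => [|k IH] y By; rewrite ?mul1r // exprSr -mulrA; apply/IH/BM.
have fn : f ^+ n = - \sum_(i < n) q`_i * f ^+ i.
  move: qmon; rewrite monicE lead_coefE qsz /= => /eqP lc.
  apply/eqP; rewrite -addr_eq0 -[X in X + _]mul1r -lc addrC; apply/eqP.
  by move: qf; rewrite horner_coef qsz big_ord_recr.
elim/ltn_ind => k IH.
have [ltkn|lenk] := ltnP k n; first exact/BX/BD.
rewrite -[in f ^+ k](subnK lenk) exprD fn mulrN mulrN mulrN; apply: BN.
rewrite !mulr_sumr; apply: (big_ind B) => // i _.
have lti := ltn_ord i.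
have -> : T ^+ k * (D * (f ^+ (k - n) * (q`_i * f ^+ i))) =
    (T * q`_i) * (T ^+ (n - i).-1 *
       (T ^+ (k - n + i) * (D * f ^+ (k - n + i)))).
  rewrite -[in T ^+ k](_ : 1 + ((n - i).-1 + (k - n + i)) = k)%N; last by lia.
  by rewrite !exprD expr1; ring.
by apply: (BM) => //; apply/BX/IH; lia.
Qed.

(** * Dickson's lemma *)

Lemma monotone_subsequence (f : nat -> nat) :
  exists u : nat -> nat, {homo u : i j / (i < j)%N} /\
    {homo f \o u : i j / (i <= j)%N}.
Proof.
have minS N : exists i, (N <= i)%N /\ forall j, (N <= j)%N -> (f i <= f j)%N.
  have ex : exists v, `[< exists2 i, (N <= i)%N & f i = v >].
    by exists (f N); apply/asboolP; exists N.
  case: (ex_minnP ex) => v /asboolP [i Ni <-] vmin; exists i; split=> // j Nj.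
  by apply: vmin; apply/asboolP; exists j.
(* [h N] is a position where the tail of [f] starting at [N] attains its minimum; the subsequence
   restarts just after each such position. *)
have /choice [h hP] := minS.
pose u := fix u n := if n is n'.+1 then h (u n').+1 else h 0%N.
have uS n : (u n < u n.+1)%N by have [] := hP (u n).+1.
have um : {homo u : i j / (i < j)%N} by apply: homo_ltn => // ? ? ?; apply: ltn_trans.
exists u; split=> //; apply: homo_leq => //= [? ? ?|n]; first exact: leq_trans.
case: n => [|n] /=; first by have [_] := hP 0%N; apply.
have [_] := hP (u n).+1; apply; apply: ltnW.
have := uS n; have := uS n.+1; rewrite /=; lia.
Qed.

(** Thinning the sequence once per coordinate makes all coordinates nondecreasing along a common
    subsequence. *)
Lemma dickson p (f : nat -> 'X_{1..p}) :
  exists i j, (i < j)%N /\ (f i <= f j)%MM.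
Proof.
suff [u [um fm]] : exists u : nat -> nat, {homo u : i j / (i < j)%N} /\
    forall k : 'I_p, {homo (fun i => f (u i) k) : i j / (i <= j)%N}.
  exists (u 0%N), (u 1%N); split; first exact: um.
  by apply/mnm_lepP => k; apply: fm.
have: forall q, (q <= p)%N -> exists u : nat -> nat,
    {homo u : i j / (i < j)%N} /\ forall k : 'I_p, (k < q)%N ->
    {homo (fun i => f (u i) k) : i j / (i <= j)%N}.
  elim=> [|q IH] leq; first by exists id; split.
  have [u [um fm]] := IH (ltnW leq).
  have [v [vm fvm]] := monotone_subsequence (fun i => f (u i) (Ordinal leq)).
  exists (u \o v); split=> [i j /vm /um //|k].
  rewrite ltnS leq_eqVlt => /orP [/eqP kq|ltkq].
    have -> : k = Ordinal leq by apply: val_inj.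
    exact: fvm.
  by move=> i j /(ltnW_homo vm); apply: fm.
by move=> /(_ p (leqnn p)) [u [um fm]]; exists u; split=> // k; apply: fm.
Qed.

Lemma mnm_neq0_split p (b : 'X_{1..p}) : b != 0%MM ->
  exists j c, b j != 0%N /\ b = (U_(j) + c)%MM.
Proof.
move=> b0; have [j bj] : exists j, b j != 0%N.
  apply: contrapT => nex; case/eqP: b0; apply/mnmP => j; rewrite mnm0E.
  by apply/eqP; apply: contraT => bj; case: nex; exists j.
by exists j, (b - U_(j))%MM; rewrite addmC submK // lep1mP.
Qed.

Lemma multinom_ind p (Q : 'X_{1..p} -> Prop) :
  Q 0%MM -> (forall j b, Q b -> Q (U_(j) + b)%MM) -> forall b, Q b.
Proof.
move=> Q0 QU b; have [k] := ubnP (mdeg b); elim: k b => // k IH b ltk.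
have [->//|/mnm_neq0_split [j [c [_ E]]]] := eqVneq b 0%MM.
rewrite E; apply: QU; apply: IH.
by move: ltk; rewrite E mdegD mdeg1; lia.
Qed.

(** * Laurent polynomials *)

Definition mrow (n : nat) (M : 'X_{1..n}) : 'rV[int]_n := \row_i (M i)%:Z.

Lemma mrowD n (M N : 'X_{1..n}) : mrow (M + N)%MM = mrow M + mrow N.
Proof. by apply/rowP => i; rewrite !mxE mnmDE. Qed.

Lemma mrow0 n : mrow (0%MM : 'X_{1..n}) = 0.
Proof. by apply/rowP => i; rewrite !mxE mnm0E. Qed.

Lemma mrowMn s (x : 'X_{1..s}) k : mrow (x *+ k)%MM = mrow x *+ k.
Proof. by apply/rowP => j; rewrite mxE mulmnE mulmxnE mxE; lia. Qed.

Lemma mrow_inj n : injective (@mrow n).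
Proof. by move=> M N /rowP E; apply/mnmP => i; have := E i; rewrite !mxE => -[]. Qed.

Lemma mrowK (n : nat) (v : 'rV[int]_n) : (forall i, 0 <= v 0 i) ->
  mrow [multinom absz (v 0%R i) | i < n] = v.
Proof. by move=> v0; apply/rowP => i; rewrite mxE mnmE gez0_abs. Qed.

Section Rows.
Context (s : nat).

(** Finitely many Laurent monomials have a common monomial denominator: the sums of the absolute
    values of all exponents are large enough. *)
Lemma row_shift (I : finType) (m : I -> 'rV[int]_s) :
  exists (N : 'X_{1..s}) (M : I -> 'X_{1..s}), forall i, m i + mrow N = mrow (M i).
Proof.
exists [multinom (\sum_i absz (m i 0%R k))%N | k < s].
exists (fun i => [multinom absz (m i 0 k + (\sum_j absz (m j 0%R k))%N%:Z)%R | k < s]) => i.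
rewrite -[RHS]/(mrow _); apply/rowP => k; rewrite !mxE !mnmE.
rewrite gez0_abs // (bigD1 i) //=; move: (m i 0 k) (\sum_(_ | _) _)%N => a b; lia.
Qed.

Lemma semigroupMn (S : set 'rV[int]_s) (S0 : S 0)
    (SD : forall m n, S m -> S n -> S (m + n)) m n : S m -> S (m *+ n).
Proof. by move=> Sm; elim: n => [|n IH]; rewrite ?mulr0n // mulrS; apply: SD. Qed.

End Rows.

Section LaurentAlgebra.
Context (R : realType) (s : nat).
Local Notation C := R[i].
Local Notation K := {fraction {mpoly C[s]}}.
Local Notation xm := (@laurent_monomial R s).
Local Notation "f %:F" := (tofrac f : K).
Implicit Types (S T : set 'rV[int]_s) (m : 'rV[int]_s) (x y f : K).

Lemma X_neq0 (i : 'I_s) : ('X_i : {mpoly C[s]})%:F != 0.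
Proof. by rewrite tofrac_eq0 -msize_poly_eq0 msizeX. Qed.

Lemma laurent_monomialD m n : xm (m + n) = xm m * xm n.
Proof.
rewrite -big_split; apply: eq_bigr => i _ /=.
by rewrite mxE expfzDr // X_neq0.
Qed.

Lemma laurent_monomial0 : xm 0 = 1.
Proof. by apply: big1 => i _; rewrite mxE. Qed.

Lemma laurent_monomial_neq0 m : xm m != 0.
Proof. by rewrite prodf_seq_neq0; apply/allP => i _; rewrite /= expfz_neq0 ?X_neq0. Qed.

Lemma laurent_monomialN m : xm (- m) = (xm m)^-1.
Proof.
by apply: (mulfI (laurent_monomial_neq0 m)); rewrite -laurent_monomialD subrr
  laurent_monomial0 divff // laurent_monomial_neq0.
Qed.

Lemma laurent_monomialMn m n : xm (m *+ n) = xm m ^+ n.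
Proof.
elim: n => [|n IH]; first by rewrite mulr0n laurent_monomial0.
by rewrite mulrS laurent_monomialD IH exprS.
Qed.

Lemma laurent_monomial_mrow (M : 'X_{1..s}) : xm (mrow M) = ('X_[M])%:F.
Proof.
rewrite mpolyXE_id rmorph_prod; apply: eq_bigr => i _ /=.
by rewrite mxE rmorphXn.
Qed.

(** The embedding [const] packaged as a ring morphism; the two are convertible. *)
Definition kconst : {rmorphism C -> K} := (@tofrac {mpoly C[s]}) \o (@mpolyC s C).

Lemma semigroup_algebra0 S : semigroup_algebra S (0 : K).
Proof.
exists 0%N, (fun=> 0), (fun=> 0); split; first by case.
by rewrite big_ord0.
Qed.

Lemma semigroup_algebraD S x y : semigroup_algebra S x ->
  semigroup_algebra S y -> semigroup_algebra S (x + y).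
Proof.
move=> [k [c [m [Sm ->]]]] [l [d [n [Sn ->]]]].
pose glue (A : Type) (u : 'I_k -> A) (v : 'I_l -> A) i :=
  match fintype.split i with inl a => u a | inr b => v b end.
exists (k + l)%N, (glue _ c d), (glue _ m n); split.
  by move=> i; rewrite /glue; case: fintype.split.
rewrite big_split_ord /glue; congr (_ + _); apply: eq_bigr => i _.
  by rewrite (unsplitK (inl i)).
by rewrite (unsplitK (inr i)).
Qed.

Lemma semigroup_algebra_sum S (I : Type) (r : seq I) (F : I -> K) :
  (forall i, semigroup_algebra S (F i)) -> semigroup_algebra S (\sum_(i <- r) F i).
Proof.
by move=> SF; apply: big_ind => //; [apply: semigroup_algebra0|apply: semigroup_algebraD].
Qed.

Lemma semigroup_algebra_term S (c : C) m : S m ->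
  semigroup_algebra S (kconst c * xm m).
Proof.
by move=> Sm; exists 1%N, (fun=> c), (fun=> m); rewrite big_ord1.
Qed.

Lemma semigroup_algebra_monomial S m : S m -> semigroup_algebra S (xm m).
Proof. by move=> /(semigroup_algebra_term 1); rewrite rmorph1 mul1r. Qed.

Lemma semigroup_algebra_ind S (P : K -> Prop) : P 0 ->
  (forall x y, P x -> P y -> P (x + y)) ->
  (forall c m, S m -> P (kconst c * xm m)) ->
  forall x, semigroup_algebra S x -> P x.
Proof.
move=> P0 PD Pt _ [k [c [m [Sm ->]]]].
by apply: big_ind => // i _; apply: Pt.
Qed.

Section Semigroup.
Context (S : set 'rV[int]_s) (S0 : S 0) (SD : forall m n, S m -> S n -> S (m + n)).

Lemma semigroup_algebra_const (c : C) : semigroup_algebra S (kconst c).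
Proof. by rewrite -[kconst c]mulr1 -laurent_monomial0; apply: semigroup_algebra_term. Qed.

Lemma semigroup_algebraM x y : semigroup_algebra S x ->
  semigroup_algebra S y -> semigroup_algebra S (x * y).
Proof.
move=> Sx Sy; move: x Sx; apply: semigroup_algebra_ind => [|a b|c m Sm].
- by rewrite mul0r; apply: semigroup_algebra0.
- by rewrite mulrDl; apply: semigroup_algebraD.
move: y Sy; apply: semigroup_algebra_ind => [|a b|d n Sn].
- by rewrite mulr0; apply: semigroup_algebra0.
- by rewrite mulrDr; apply: semigroup_algebraD.
rewrite mulrACA -rmorphM -laurent_monomialD.
exact/semigroup_algebra_term/SD.
Qed.

Lemma semigroup_algebraB x y : semigroup_algebra S x ->
  semigroup_algebra S y -> semigroup_algebra S (x - y).
Proof.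
move=> Sx Sy; apply: semigroup_algebraD => //; rewrite -mulN1r -(rmorphN1 kconst).
by apply: semigroup_algebraM => //; apply: semigroup_algebra_const.
Qed.

End Semigroup.

Lemma semigroup_algebra_denominator S x : semigroup_algebra S x ->
  exists (N : 'X_{1..s}) (P : {mpoly C[s]}), x * xm (mrow N) = P%:F.
Proof.
move=> [k [c [m [_ ->]]]]; have [N [M NM]] := row_shift m.
exists N, (\sum_i (c i)%:MP * 'X_[M i]).
rewrite mulr_suml rmorph_sum; apply: eq_bigr => i _ /=.
by rewrite -mulrA -laurent_monomialD NM laurent_monomial_mrow rmorphM.
Qed.

(** The exponent [mlead P] shifted by [N] has a nonzero coefficient in [x], so it occurs among the
    exponents of any expression of [x] by characters of [S]. This turns membership in C[S] into
    membership in S. *)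
Lemma semigroup_algebra_mlead S x (N : 'X_{1..s}) (P : {mpoly C[s]}) :
  semigroup_algebra S x -> x * xm (mrow N) = P%:F -> P != 0 ->
  S (mrow (mlead P) - mrow N).
Proof.
move=> [k [c [m [Sm ->]]]] EP Pn0; have [L [M LM]] := row_shift m.
have : P * 'X_[L] = 'X_[N] * (\sum_i (c i)%:MP * 'X_[M i]).
  apply/eqP; rewrite -tofrac_eq !rmorphM /= -!laurent_monomial_mrow -EP; apply/eqP; rewrite mulrAC mulrC.
  congr (_ * _); rewrite mulr_suml rmorph_sum; apply: eq_bigr => i _ /=.
  by rewrite -mulrA -laurent_monomialD LM laurent_monomial_mrow rmorphM.
move/(congr1 (mcoeff (mlead P + L))); rewrite addmC mcoeffMX.
rewrite mulr_sumr raddf_sum => /esym sumn0.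
have [j jn0] : exists j, ((('X_[N] : {mpoly C[s]}) * ((c j)%:MP * 'X_[M j]))@_(L + mlead P)%MM != 0).
  apply/existsP; rewrite -negb_forall; apply: contraNN Pn0 => /forallP all0.
  rewrite -mleadc_eq0 -sumn0; apply/eqP/big1 => j _.
  exact/eqP/all0.
move: jn0; rewrite mulrCA mul_mpolyC -mpolyXD mcoeffZ mcoeffX mulf_eq0 negb_or => /andP [_].
rewrite pnatr_eq0 eqb0 negbK => /eqP /(congr1 (@mrow s)).
rewrite !mrowD -LM => E; suff -> : mrow (mlead P) - mrow N = m j by [].
by apply/rowP => l; move/rowP/(_ l): E; rewrite !mxE; lia.
Qed.

End LaurentAlgebra.

(** * Normalization of a semigroup algebra *)

Section Semigroups.
Context (s : nat).
Implicit Types (S T G : set 'rV[int]_s) (m n x y : 'rV[int]_s).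

Definition add_closed T := forall m n, T m -> T n -> T (m + n).

Lemma generated0 G : semigroup_generated_by G 0.
Proof.
exists 0%N, (fun=> 0), (fun=> 0); split; [by case|by case|].
by rewrite big_ord0.
Qed.

Lemma generatedD G : add_closed (semigroup_generated_by G).
Proof.
move=> _ _ [k [a [u [a0 Gu ->]]]] [l [b [v [b0 Gv ->]]]].
pose glue (A : Type) (f : 'I_k -> A) (h : 'I_l -> A) i :=
  match fintype.split i with inl e => f e | inr e => h e end.
exists (k + l)%N, (glue _ a b), (glue _ u v); split.
- by move=> e; rewrite /glue; case: fintype.split.
- by move=> e; rewrite /glue; case: fintype.split.
rewrite big_split_ord /glue; congr (_ + _); apply: eq_bigr => e _.
  by rewrite (unsplitK (inl e)).
by rewrite (unsplitK (inr e)).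
Qed.

Lemma generated_mem G : G `<=` semigroup_generated_by G.
Proof.
move=> m Gm; exists 1%N, (fun=> 1), (fun=> m); split=> //.
by rewrite big_ord1 scale1r.
Qed.

Lemma scale_nonneg (a : int) x : 0 <= a -> a *: x = x *+ `|a|%N.
Proof. by move=> a0; rewrite -scaler_nat natz gez0_abs. Qed.

Lemma generated_min G T : T 0 -> add_closed T -> G `<=` T ->
  semigroup_generated_by G `<=` T.
Proof.
move=> T0 TD GT _ [k [a [v [a0 Gv ->]]]].
apply: big_ind => // e _; rewrite scale_nonneg //; last exact: a0.
by apply: semigroupMn => //; apply: GT.
Qed.

(** The map pi_S on N^p. *)
Definition gsum p (g : 'I_p -> 'rV[int]_s) (b : 'X_{1..p}) := \sum_j g j *+ b j.

Lemma gsumD p (g : 'I_p -> 'rV[int]_s) b c :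
  gsum g (b + c)%MM = gsum g b + gsum g c.
Proof.
by rewrite -big_split; apply: eq_bigr => j _; rewrite mnmDE mulrnDr.
Qed.

Lemma gsum0 p (g : 'I_p -> 'rV[int]_s) : gsum g 0%MM = 0.
Proof. by apply: big1 => j _; rewrite mnm0E. Qed.

Lemma gsumU p (g : 'I_p -> 'rV[int]_s) j : gsum g U_(j)%MM = g j.
Proof.
rewrite /gsum (bigD1 j) //= mnm1E eqxx big1 ?addr0 // => e ne.
by rewrite mnm1E eq_sym (negPf ne).
Qed.

Lemma gsum_mulmx p (g : 'I_p -> 'rV[int]_s) b :
  gsum g b = mrow b *m \matrix_j g j.
Proof.
apply/rowP => k; rewrite mxE summxE; apply: eq_bigr => j _.
by rewrite !mxE mulmxnE mulrC -mulr_natr natz.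
Qed.

Lemma generatedP p (g : 'I_p -> 'rV[int]_s) x :
  semigroup_generated_by (range g) x <-> exists b, x = gsum g b.
Proof.
split.
  move: x; apply: generated_min; first by exists 0%MM; rewrite gsum0.
    by move=> _ _ [b ->] [c ->]; exists (b + c)%MM; rewrite gsumD.
  by move=> _ [j _ <-]; exists U_(j)%MM; rewrite gsumU.
move=> [b ->]; apply: big_ind => //; [exact: generated0|exact: generatedD|].
move=> j _; apply: semigroupMn; [exact: generated0|exact: generatedD|].
by apply: generated_mem; exists j.
Qed.

Lemma group_generated_min G T : T 0 -> add_closed T -> (forall m, T m -> T (- m)) ->
  G `<=` T -> group_generated_by G `<=` T.
Proof.
move=> T0 TD TN GT _ [k [a [v [a0 Gv ->]]]].
have TM m (n : nat) : T m -> T (m *+ n) by apply: semigroupMn.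
apply: big_ind => // e _; case: (a e) => n.
  by rewrite scale_nonneg //; apply/TM/GT.
by rewrite NegzE scaleNr scale_nonneg //; apply/TN/TM/GT.
Qed.

Lemma group_generated_diff S m : S 0 -> add_closed S ->
  group_generated_by S = setT -> exists u v, [/\ S u, S v & m = u - v].
Proof.
move=> S0 SD SG; have : group_generated_by S m by rewrite SG.
move: m; apply: (@group_generated_min S
  (fun m => exists u v, [/\ S u, S v & m = u - v])).
- by exists 0, 0; rewrite subrr.
- move=> _ _ [u [v [Su Sv ->]]] [u' [v' [Su' Sv' ->]]].
  by exists (u + u'), (v + v'); split; [apply: SD|apply: SD|rewrite opprD addrACA].
- by move=> _ [u [v [Su Sv ->]]]; exists v, u; rewrite opprB.
- by move=> m Sm; exists m, 0; rewrite subr0.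
Qed.

Definition saturation S := [set m | exists2 k, (0 < k)%N & S (m *+ k)].

Lemma saturation_sub S : S `<=` saturation S.
Proof. by move=> m Sm; exists 1%N. Qed.

Lemma saturationD S : S 0 -> add_closed S -> add_closed (saturation S).
Proof.
move=> S0 SD m n [k k0 Sm] [l l0 Sn]; exists (k * l)%N; first by rewrite muln_gt0 k0.
rewrite mulrnDl; apply: (SD); first by rewrite mulrnA; apply: semigroupMn.
by rewrite mulnC mulrnA; apply: semigroupMn.
Qed.

(** Write d + k m as the image of an exponent b_k in N^p. Dickson's lemma gives k < l with b_k <=
    b_l, and b_l - b_k then represents (l - k) m. *)
Lemma saturation_of_ray p (g : 'I_p -> 'rV[int]_s) (d m : 'rV[int]_s) :
  (forall k, semigroup_generated_by (range g) (d + m *+ k)) ->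
  saturation (semigroup_generated_by (range g)) m.
Proof.
move=> ray.
have /choice [b bE] : forall k, exists b, d + m *+ k = gsum g b.
  by move=> k; apply/generatedP.
have [k [l [ltkl /submK bkl]]] := dickson b.
exists (l - k)%N; first by rewrite subn_gt0.
apply/generatedP; exists (b l - b k)%MM.
apply: (addIr (gsum g (b k))); rewrite -gsumD bkl -!bE.
by rewrite addrCA -mulrnDr subnK // ltnW.
Qed.

End Semigroups.

(** * Integral and almost integral elements *)

Section IntegralClosure.
Context (A : comNzRingType) (K : fieldType) (psi : {rmorphism A -> K}).

Lemma integral_closureP (B : set K) : (forall x, B x <-> exists a, x = psi a) ->
  forall x, (exists q : {poly K}, [/\ q \is monic, forall e : nat, B q`_e & root q x])
    <-> integralOver psi x.
Proof.
move=> BP x; split=> [[q [qm Bq qx]]|[q qm qx]].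
  apply: integral_root_monic qm qx _; apply/integral_poly => e.
  by have /BP [a ->] := Bq e; apply: integral_id.
exists (map_poly psi q); split=> //; first exact: monic_map.
by move=> e; apply/BP; rewrite coef_map; exists q`_e.
Qed.

Lemma integral_of_power k a (x : K) : (0 < k)%N -> psi a = x ^+ k -> integralOver psi x.
Proof.
move=> k0 Ea; exists ('X^k - a%:P); first by rewrite monicE lead_coefXnsubC.
by rewrite rmorphB /= map_polyXn map_polyC /= rootE !hornerE Ea subrr.
Qed.

Lemma monic_sizeS (L : nzRingType) (q : {poly L}) : q \is monic ->
  exists n, size q = n.+1.
Proof.
by move=> qm; exists (size q).-1; rewrite prednK // lt0n size_poly_eq0 monic_neq0.
Qed.

(** Here D is b^n with n the degree of [q]: it clears the denominators of the powers of [x] below n,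
    and the monic equation reduces all others to these. *)
Lemma almost_integral_of_monic (B : set K) (q : {poly K}) (a b x : K) :
  B 0 -> B 1 -> (forall y z, B y -> B z -> B (y - z)) ->
  (forall y z, B y -> B z -> B (y * z)) -> q \is monic ->
  (forall e : nat, B q`_e) -> root q x -> B a -> B b -> b != 0 -> x = a / b ->
  exists2 D, D != 0 & B D /\ forall k, B (D * x ^+ k).
Proof.
move=> B0 B1 BB BM qm Bq qx Ba Bb b0 xE; have [n sq] := monic_sizeS qm.
have BX y k : B y -> B (y ^+ k).
  by move=> By; elim: k => [|k IH]; rewrite ?expr0 // exprS; apply: BM.
exists (b ^+ n); first by rewrite expf_neq0.
split; first exact: BX.
move=> k; rewrite -[X in B X]mul1r -(expr1n _ k).
apply: (almost_integral_powers (q := q) (n := n)) => //.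
  by move=> e; rewrite mul1r.
move=> l ltln; rewrite xE expr_div_n mulrCA -expfB //.
by apply: BM; apply: BX.
Qed.

(** Produces the hypothesis of [mpoly_dvd_of_powers] for [M * P] and [Q]: [M] clears the
    denominators of the coefficients of [q], hence those of its equation at each power, and [Q ^+ n]
    clears the powers of [x] below n. *)
Lemma integral_divisibility (P Q M : A) (q : {poly K}) (x : K) :
  injective psi -> psi Q != 0 -> x = psi P / psi Q -> q \is monic -> root q x ->
  (forall e : nat, exists a, psi M * q`_e = psi a) ->
  exists n, forall k, exists a, Q ^+ n * (M * P) ^+ k = Q ^+ k * a.
Proof.
move=> psi_inj Q0 xE qm qx qM; have [n sq] := monic_sizeS qm; exists n => k.
have [a aE] : exists a, psi M ^+ k * (psi Q ^+ n * x ^+ k) = psi a.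
  move: k; apply: (almost_integral_powers (B := [set y | exists a, y = psi a])
    _ _ _ qm sq qx) => /=.
  - by exists 0; rewrite rmorph0.
  - by move=> _ _ [a ->] [b ->]; exists (a - b); rewrite rmorphB.
  - by move=> _ _ [a ->] [b ->]; exists (a * b); rewrite rmorphM.
  - by exists M.
  - exact: qM.
  move=> l ltln; exists (P ^+ l * Q ^+ (n - l)).
  by rewrite xE expr_div_n rmorphM !rmorphXn /= mulrCA -expfB.
exists a; apply: psi_inj; rewrite !rmorphM -aE !rmorphXn rmorphM /= xE.
by rewrite expr_div_n exprMn; field; rewrite expf_neq0.
Qed.

Lemma frac_cleared (P Q M a : A) (x : K) : psi Q != 0 -> x = psi P / psi Q ->
  M * P = Q * a -> x * psi M = psi a.
Proof.
move=> Q0 xE E; apply: (mulfI Q0); rewrite -rmorphM -E rmorphM xE.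
by rewrite mulrA mulrC; congr (_ * _); rewrite mulrCA divff ?mulr1.
Qed.

Lemma frac_of_frac (a b u v x : K) (P Q N M : A) : b != 0 -> u != 0 -> v != 0 ->
  psi N = u -> psi M = v -> a * u = psi P -> b * v = psi Q -> x = a / b ->
  psi (Q * N) != 0 /\ x = psi (P * M) / psi (Q * N).
Proof.
move=> b0 u0 v0 EN EM EP EQ xE; rewrite !rmorphM EN EM -EP -EQ !mulf_neq0 //.
by split=> //; rewrite xE; field; rewrite b0 u0 v0.
Qed.

End IntegralClosure.

Section Normalization.
Context (R : realType) (s p : nat) (g : 'I_p -> 'rV[int]_s).
Local Notation C := R[i].
Local Notation K := {fraction {mpoly C[s]}}.
Local Notation xm := (@laurent_monomial R s).
Local Notation "f %:F" := (tofrac f : K).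
Local Notation S := (semigroup_generated_by (range g)).
Hypothesis SG : group_generated_by S = setT.

Let S0 : S 0. Proof. exact: generated0. Qed.
Let SD : add_closed S. Proof. exact: generatedD. Qed.

(** The presentation of C[S] by its generators. It makes C[S] the image of a ring morphism, the form
    in which [integralOver] is stated. *)
Definition toric_param : {rmorphism {mpoly C[p]} -> K} :=
  mmap (kconst R s) (fun j => xm (g j)).

Lemma toric_paramX b : toric_param 'X_[b] = xm (gsum g b).
Proof.
rewrite /toric_param /= mmapX /mmap1 /gsum.
elim/big_rec2: _ => [|j y x _ ->]; first by rewrite laurent_monomial0.
by rewrite laurent_monomialD laurent_monomialMn.
Qed.

Lemma semigroup_algebraP (x : K) : semigroup_algebra S x <-> exists P, x = toric_param P.
Proof.
split.
  move: x; apply: semigroup_algebra_ind; first by exists 0; rewrite rmorph0.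
    by move=> _ _ [P ->] [Q ->]; exists (P + Q); rewrite rmorphD.
  move=> c m /generatedP [b ->]; exists (c%:MP * 'X_[b]).
  by rewrite rmorphM toric_paramX /= mmapC.
move=> [P ->]; rewrite /toric_param /= [P]mpolyE raddf_sum /=.
apply: semigroup_algebra_sum => b; rewrite mmapZ.
have /= -> := toric_paramX b.
by apply: semigroup_algebra_term; apply/generatedP; exists b.
Qed.

Lemma function_fieldD (x y : K) : function_field S x -> function_field S y ->
  function_field S (x + y).
Proof.
move=> [a [b [Sa Sb b0 ->]]] [c [d [Sc Sd d0 ->]]].
exists (a * d + c * b), (b * d); split; last exact: (addf_div _ _ b0 d0).
- by apply: semigroup_algebraD; apply: semigroup_algebraM.
- exact: semigroup_algebraM.
- exact: (mulf_neq0 b0 d0).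
Qed.

Lemma function_field_algebra T (x : K) : semigroup_algebra T x -> function_field S x.
Proof.
move: x; apply: semigroup_algebra_ind; last 1 first.
- move=> c m _; have [u [v [Su Sv ->]]] := group_generated_diff m S0 SD SG.
  exists (kconst R s c * xm u), (xm v); split.
  + exact: semigroup_algebra_term.
  + exact: semigroup_algebra_monomial.
  + exact: laurent_monomial_neq0.
  + by rewrite laurent_monomialD laurent_monomialN mulrA.
- exists 0, 1; rewrite mul0r oner_neq0; split=> //; first exact: semigroup_algebra0.
  by rewrite -(rmorph1 (kconst R s)); apply: semigroup_algebra_const.
- exact: function_fieldD.
Qed.

Lemma normalizedP (x : K) :
  normalized_algebra S x <-> function_field S x /\ integralOver toric_param x.
Proof.
have [int1 int2] := integral_closureP semigroup_algebraP x.
by split=> -[Fx]; [move/int1|move/int2].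
Qed.

Lemma integral_monomial m : saturation S m -> integralOver toric_param (xm m).
Proof.
move=> [k k0 /generatedP [b Eb]]; apply: (@integral_of_power _ _ _ k 'X_[b]) => //.
by rewrite toric_paramX -laurent_monomialMn Eb.
Qed.

Lemma integral_saturation_algebra (x : K) :
  semigroup_algebra (saturation S) x -> integralOver toric_param x.
Proof.
move: x; apply: semigroup_algebra_ind; first exact: integral0.
  by move=> x y; apply: integral_add.
move=> c m Sm; apply: integral_mul; last exact: integral_monomial.
have <- : toric_param c%:MP = kconst R s c by rewrite /toric_param /= mmapC.
exact: integral_id.
Qed.

Lemma almost_integral (x : K) : normalized_algebra S x ->
  exists2 D, D != 0 & semigroup_algebra S D /\
    forall k, semigroup_algebra S (D * x ^+ k).
Proof.
move=> [[a [b [Sa Sb b0 xE]]] [q [qm Sq qx]]].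
apply: (almost_integral_of_monic _ _ _ _ qm Sq qx Sa Sb b0 xE).
- exact: semigroup_algebra0.
- by rewrite -(rmorph1 (kconst R s)); apply: semigroup_algebra_const.
- by move=> ? ?; apply: semigroup_algebraB.
- by move=> ? ?; apply: semigroup_algebraM.
Qed.

(** Write x = P / Q and let the monomial [M] clear the coefficients of its integral equation. Then M
    x is almost integral over the polynomial ring, so Q divides M P, and only a monomial denominator
    remains. *)
Lemma normalized_laurent (x : K) : normalized_algebra S x ->
  exists (N : 'X_{1..s}) (P : {mpoly C[s]}), x * xm (mrow N) = P%:F.
Proof.
move=> [[a [b [Sa Sb b0 xE]]] [q [qm Sq qx]]].
have [N0 [P0 P0E]] := semigroup_algebra_denominator Sa.
have [M0 [Q0 Q0E]] := semigroup_algebra_denominator Sb.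
have [] := frac_of_frac (psi := @tofrac {mpoly C[s]}) b0 (laurent_monomial_neq0 _ _)
  (laurent_monomial_neq0 _ _) (esym (laurent_monomial_mrow R N0))
  (esym (laurent_monomial_mrow R M0)) P0E Q0E xE.
move: (P0 * _) (Q0 * _) => P Q {a b N0 M0 P0 Q0 P0E Q0E Sa Sb b0 xE} Qn0 xE.
have /choice [N NP] := fun e => semigroup_algebra_denominator (Sq e).
pose M := (\sum_(e < size q) N e)%MM.
have qM e : exists P, ('X_[M])%:F * q`_e = P%:F.
  have [lte|gte] := ltnP e (size q); last by exists 0; rewrite nth_default // mulr0 rmorph0.
  have [Pe PeE] := NP e.
  exists ('X_[\sum_(d < size q | d != Ordinal lte) N d] * Pe).
  rewrite rmorphM /= -PeE /M (bigD1 (Ordinal lte)) //= mpolyXD rmorphM /=.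
  by rewrite -(laurent_monomial_mrow R (N e)) mulrAC mulrC; congr (_ * _); rewrite mulrC.
have tofrac_inj : injective (@tofrac {mpoly C[s]}).
  by move=> y z /eqP; rewrite tofrac_eq => /eqP.
have [n divn] := integral_divisibility tofrac_inj Qn0 xE qm qx qM.
have Qnz : Q != 0 by rewrite -tofrac_eq0.
have [A AE] := mpoly_dvd_of_powers Qnz (expf_neq0 n Qnz) divn.
by exists M, A; rewrite laurent_monomial_mrow; apply: frac_cleared Qn0 xE AE.
Qed.

(* The leading exponent m of x satisfies d + k m \in S for some d and all k, so m is in the
   saturation by Dickson's lemma, and the leading term can be subtracted. *)
Lemma integral_laurent_saturation (x : K) N (P : {mpoly C[s]}) :
  normalized_algebra S x -> x * xm (mrow N) = P%:F ->
  semigroup_algebra (saturation S) x.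
Proof.
elim/mleadrect: P x => P IH x Nx xE.
have [P0|Pn0] := eqVneq P 0.
  suff -> : x = 0 by exact: semigroup_algebra0.
  by apply: (mulIf (laurent_monomial_neq0 R (mrow N))); rewrite xE P0 rmorph0 mul0r.
have [D Dn0 [SDD almD]] := almost_integral Nx.
have [M [Q QE]] := semigroup_algebra_denominator SDD.
have Qn0 : Q != 0.
  by have := mulf_neq0 Dn0 (laurent_monomial_neq0 R (mrow M)); rewrite QE tofrac_eq0.
pose m := mrow (mlead P) - mrow N.
have Sm : saturation S m.
  (* Every [D * x ^+ k] lies in C[S], and its leading exponent is that of [D] plus k times [m]. *)
  apply: (@saturation_of_ray _ _ _ (mrow (mlead Q) - mrow M)) => k.
  have := @semigroup_algebra_mlead _ _ _ _ (M + N *+ k)%MM (Q * P ^+ k) (almD k).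
  rewrite mleadM ?expf_neq0 // mleadX // mulf_neq0 ?expf_neq0 //.
  have mrowMn (L : 'X_{1..s}) : mrow (L *+ k)%MM = mrow L *+ k.
    by apply/rowP => j; rewrite mxE mulmnE mulmxnE mxE; lia.
  have -> : mrow (mlead Q + mlead P *+ k)%MM - mrow (M + N *+ k)%MM =
      mrow (mlead Q) - mrow M + m *+ k.
    by rewrite !mrowD !mrowMn mulrnBl opprD addrACA.
  apply=> //.
  rewrite mrowD mrowMn laurent_monomialD laurent_monomialMn rmorphM rmorphXn /=.
  by rewrite -QE -xE exprMn mulrACA.
pose y := kconst R s (mleadc P) * xm m.
have Sy : semigroup_algebra (saturation S) y by apply: semigroup_algebra_term.
pose P' := P - (mleadc P) *: 'X_[mlead P].
have yE : (x - y) * xm (mrow N) = P'%:F.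
  rewrite mulrBl xE /P' rmorphB /= -mul_mpolyC rmorphM /= -laurent_monomial_mrow.
  by rewrite -mulrA -laurent_monomialD subrK.
rewrite -[x](subrK y); apply: semigroup_algebraD => //.
have [P'0|P'n0] := eqVneq P' 0.
  suff -> : x - y = 0 by exact: semigroup_algebra0.
  by apply: (mulIf (laurent_monomial_neq0 R (mrow N))); rewrite yE P'0 rmorph0 mul0r.
apply: IH yE.
  apply: mlead_sub_lt; rewrite ?mleadZ ?mleadc_eq0 ?mleadXm //.
    by rewrite mcoeffZ mcoeffX eqxx mulr1.
  by rewrite -subr_eq0.
have [[Fx Ix] Iy] := (iffLR (normalizedP x) Nx, integral_saturation_algebra Sy).
apply/normalizedP; split; last exact: (integral_sub Ix Iy).
apply: (function_fieldD Fx); apply: (@function_field_algebra (saturation S)).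
have -> : - y = kconst R s (- mleadc P) * xm m by rewrite (rmorphN (kconst R s)) mulNr.
exact: semigroup_algebra_term.
Qed.

Lemma normalized_saturation :
  normalized_algebra S = semigroup_algebra (saturation S) :> set K.
Proof.
apply/seteqP; split=> x.
  move=> Nx; have [N [P xE]] := normalized_laurent Nx.
  exact: integral_laurent_saturation Nx xE.
move=> Sx; apply/normalizedP; split; first exact: function_field_algebra Sx.
exact: integral_saturation_algebra.
Qed.

End Normalization.

(** * Semigroups whose normalization is a polynomial ring *)

Section FreeNormalization.
Context (R : realType) (s : nat).
Local Notation C := R[i].
Local Notation K := {fraction {mpoly C[s]}}.
Local Notation xm := (@laurent_monomial R s).
Local Notation kc := (kconst R s).
Local Notation "f %:F" := (tofrac f : K).
Implicit Types (T : set 'rV[int]_s) (h m : 'rV[int]_s) (x y : K).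

(* c is the coefficient of x^h in the Laurent polynomial y. *)
Definition has_coef h y (c : C) := exists N M (P : {mpoly C[s]}),
  [/\ y * xm (mrow N) = P%:F, mrow M = h + mrow N & c = P@_M].

Lemma has_coef_uniq h y c d : has_coef h y c -> has_coef h y d -> c = d.
Proof.
move=> [N [M [P [EP EM ->]]]] [N' [M' [P' [EP' EM' ->]]]].
have EMN : (N' + M = N + M')%MM.
  by apply: mrow_inj; rewrite !mrowD EM EM' addrCA [RHS]addrCA [mrow N' + _]addrC.
rewrite -(mcoeffMX P N' M) EMN.
suff -> : P * 'X_[N'] = P' * 'X_[N] by rewrite mcoeffMX.
apply/eqP; rewrite -tofrac_eq !rmorphM /= -EP -EP' !laurent_monomial_mrow.
by apply/eqP; rewrite mulrAC.
Qed.

(** The value 0 is a default; on Laurent polynomials the coefficient exists and is unique. *)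
Definition lcoef h y := xget 0 (has_coef h y).

Lemma lcoefE h y c : has_coef h y c -> lcoef h y = c.
Proof.
by move=> hc; apply: has_coef_uniq (hc); rewrite /lcoef; apply: (@xgetPex _ 0 (has_coef h y)); exists c.
Qed.

Lemma lcoefP T h y : semigroup_algebra T y -> has_coef h y (lcoef h y).
Proof.
move=> Ty; apply: (@xgetPex _ 0 (has_coef h y)).
have [N [P EP]] := semigroup_algebra_denominator Ty.
have [L [M LM]] := row_shift (fun _ : 'I_1 => h).
exists (P * 'X_[L])@_(N + M ord0)%MM, (N + L)%MM, (N + M ord0)%MM, (P * 'X_[L]); split=> //.
  by rewrite rmorphM /= -EP mrowD laurent_monomialD mulrA (laurent_monomial_mrow _ L).
by rewrite !mrowD -LM addrCA.
Qed.

Lemma lcoefD T h x y : semigroup_algebra T x -> semigroup_algebra T y ->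
  lcoef h (x + y) = lcoef h x + lcoef h y.
Proof.
move=> /(lcoefP h) [N [M [P [EP EM ->]]]] /(lcoefP h) [N' [M' [P' [EP' EM' ->]]]].
apply: lcoefE; exists (N + N')%MM, (N' + M)%MM, (P * 'X_[N'] + P' * 'X_[N]); split.
- rewrite mrowD laurent_monomialD rmorphD !rmorphM /= -EP -EP' -!laurent_monomial_mrow.
  by ring.
- by rewrite !mrowD EM addrC -addrA.
have EMN : (N' + M = N + M')%MM.
  by apply: mrow_inj; rewrite !mrowD EM EM' addrCA [RHS]addrCA [mrow N' + _]addrC.
by rewrite mcoeffD mcoeffMX EMN mcoeffMX.
Qed.

Lemma lcoef_term h (c : C) m : lcoef h (kc c * xm m) = c * (m == h)%:R.
Proof.
have [L [M LM]] := row_shift (fun b : bool => if b then m else h).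
apply: lcoefE; exists L, (M false), (c%:MP * 'X_[M true]); split.
- by rewrite rmorphM /= -laurent_monomial_mrow -(LM true) laurent_monomialD mulrA.
- by rewrite -LM.
rewrite mul_mpolyC mcoeffZ mcoeffX; congr (_ * _%:R).
rewrite -(inj_eq (@mrow_inj s)) -!LM /=.
by rewrite (inj_eq (addIr _)).
Qed.

Lemma lcoef_monomial h m : lcoef h (xm m) = (m == h)%:R.
Proof. by have := lcoef_term h 1 m; rewrite rmorph1 !mul1r. Qed.

Lemma lcoef0 h : lcoef h 0 = 0.
Proof. by have := lcoef_term h 0 0; rewrite rmorph0 !mul0r. Qed.

Lemma mpoly_algebra_ind n (A : comNzRingType) (P : {mpoly A[n]} -> Prop) :
  (forall c, P c%:MP) -> (forall j, P 'X_j) ->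
  (forall p q, P p -> P q -> P (p + q)) -> (forall p q, P p -> P q -> P (p * q)) ->
  forall p, P p.
Proof.
move=> PC PX PD PM; have P1 : P 1 by rewrite -mpolyC1.
elim/mpolyind => [|c m p _ _ Pp]; first by rewrite -mpolyC0.
apply: PD => //; rewrite -mul_mpolyC; apply: (PM) => //.
rewrite mpolyXE_id; apply: big_ind; [exact: P1|exact: PM|] => j _.
by elim: (m j) => [|e IH]; rewrite ?expr0 // exprS; apply: (PM).
Qed.

(** Both sides are derivations at the point [eps], and they agree on constants and on variables,
    which generate the algebra. *)
Lemma derivation_mderiv n (A : comNzRingType) (eps D : {mpoly A[n]} -> A) :
  {morph eps : p q / p + q} -> {morph eps : p q / p * q} ->
  (forall c, eps c%:MP = c) -> {morph D : p q / p + q} -> (forall c, D c%:MP = 0) ->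
  (forall p q, D (p * q) = eps p * D q + eps q * D p) ->
  forall p, D p = \sum_j eps p^`M(j) * D 'X_j.
Proof.
move=> epsD epsM epsC DD DC DM.
have eps0 : eps 0 = 0 by rewrite -mpolyC0 epsC.
have eps1 : eps 1 = 1 by rewrite -mpolyC1 epsC.
apply: mpoly_algebra_ind => [c|j|p q IHp IHq|p q IHp IHq].
- by rewrite DC big1 // => j _; rewrite mderivC eps0 mul0r.
- rewrite (bigD1 j) //= big1 => [|k nkj]; rewrite mderivX mnm1E.
    have -> : (U_(j) - U_(j))%MM = 0%MM :> 'X_{1..n} by apply/mnmP => l; rewrite mnmBE subnn mnm0E.
    by rewrite eqxx scale1r mpolyX0 eps1 mul1r addr0.
  by rewrite eq_sym (negPf nkj) scale0r eps0 mul0r.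
- by rewrite DD IHp IHq -big_split; apply: eq_bigr => j _; rewrite mderivD epsD mulrDl.
rewrite DM IHp IHq !mulr_sumr -big_split; apply: eq_bigr => j _ /=.
by rewrite mderivM epsD !epsM; ring.
Qed.

Section Isomorphism.
Context (T : set 'rV[int]_s) (T0 : T 0) (TD : add_closed T).
Context (phi : {rmorphism {mpoly C[s]} -> K}).
Hypothesis phiC : forall c, phi c%:MP = kc c.
Hypothesis phi_bij : set_bij setT (semigroup_algebra T) phi.
Hypothesis Tgen : forall m, exists u v, [/\ T u, T v & m = u - v].

Lemma iso_inj : injective phi.
Proof. by case: phi_bij => _ inj _ p q; apply: inj; rewrite in_setE. Qed.

Lemma iso_mem p : semigroup_algebra T (phi p).
Proof. by case: phi_bij => mem _ _; apply: mem. Qed.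

Lemma iso_preimage : exists pre : 'rV[int]_s -> {mpoly C[s]},
  forall m, T m -> phi (pre m) = xm m.
Proof.
have: forall m, exists p, T m -> phi p = xm m.
  move=> m; have [Tm|] := pselect (T m); last by exists 0.
  case: phi_bij => _ _ /(_ _ (semigroup_algebra_monomial R Tm)) [p _ pE].
  by exists p => _; exact: pE.
by move=> /choice [pre preE]; exists pre.
Qed.

Lemma laurent_monomial_const m c : xm m = kc c -> m = 0.
Proof.
move=> /(congr1 (lcoef m)); rewrite lcoef_monomial eqxx.
rewrite -[kc c]mulr1 -(laurent_monomial0 R s) lcoef_term.
have [//|mn0] := eqVneq m 0.
by rewrite mulr0 => /eqP; rewrite oner_eq0.
Qed.

(* The degree of the polynomial corresponding to a character grades T. *)
Lemma iso_degree : exists dg : 'rV[int]_s -> nat,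
  (forall m n, T m -> T n -> dg (m + n)%R = (dg m + dg n)%N) /\
  (forall m, T m -> dg m = 0%N -> m = 0).
Proof.
have [pre preE] := iso_preimage.
have pre_neq0 m : T m -> pre m != 0.
  move=> Tm; apply: contraTneq (laurent_monomial_neq0 R m) => E.
  by rewrite -preE // E rmorph0 eqxx.
exists (fun m => (msize (pre m)).-1); split=> [m n Tm Tn|m Tm].
  have -> : pre (m + n) = pre m * pre n.
    apply: iso_inj; rewrite rmorphM !preE //; last exact: TD.
    exact: laurent_monomialD.
  rewrite msizeM ?pre_neq0 //.
  by rewrite (mpolySpred _ (pre_neq0 _ Tm)) (mpolySpred _ (pre_neq0 _ Tn)) addSn addnS.
move=> deg0; have /msize1_polyC E : (msize (pre m) <= 1)%N by lia.
by apply: (@laurent_monomial_const _ ((pre m)@_0%MM)); rewrite -preE // E phiC mpolyCK.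
Qed.

Definition irreducible_in m := [/\ T m, m != 0 &
  forall u v, T u -> T v -> m = u + v -> u = 0 \/ v = 0].

(** The degree is positive on nonzero elements, so a proper decomposition has two summands of
    smaller degree. *)
Lemma generated_by_irreducible : T `<=` semigroup_generated_by irreducible_in.
Proof.
have [dg [dgD dg0]] := iso_degree.
move=> m; have [k] := ubnP (dg m); elim: k m => // k IH m ltk Tm.
have [->|mn0] := eqVneq m 0; first exact: generated0.
have [irr|nirr] := pselect (irreducible_in m); first exact: generated_mem.
have [u [v [Tu Tv E un0 vn0]]] : exists u v, [/\ T u, T v, m = u + v, u <> 0 & v <> 0].
  apply: contrapT => nex; apply: nirr; split=> // u v Tu Tv E.
  have [->|un0] := eqVneq u 0; first by left.
  have [->|vn0] := eqVneq v 0; first by right.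
  by exfalso; apply: nex; exists u, v; split=> //; apply/eqP.
have ? : dg u <> 0%N by move=> /(dg0 _ Tu).
have ? : dg v <> 0%N by move=> /(dg0 _ Tv).
rewrite E dgD // in ltk *.
by apply: generatedD; apply: IH => //; lia.
Qed.

Lemma irreducible_pointed u v : T u -> T v -> u + v = 0 -> u = 0 /\ v = 0.
Proof.
have [dg [dgD dg0]] := iso_degree.
move=> Tu Tv E; have := dgD _ _ Tu Tv; have := dgD _ _ T0 T0; rewrite E addr0 => d0 d.
by split; apply: dg0 => //; lia.
Qed.

(** Bilinearity reduces a formula for the coefficients of a product to products of two terms. *)
Lemma lcoef_mul h (Psi : K -> K -> C) :
  (forall y, Psi 0 y = 0) -> (forall x, Psi x 0 = 0) ->
  (forall x x' y, semigroup_algebra T x -> semigroup_algebra T x' ->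
    Psi (x + x') y = Psi x y + Psi x' y) ->
  (forall x y y', semigroup_algebra T y -> semigroup_algebra T y' ->
    Psi x (y + y') = Psi x y + Psi x y') ->
  (forall c d m n, T m -> T n ->
    Psi (kc c * xm m) (kc d * xm n) = c * d * (m + n == h)%:R) ->
  forall x y, semigroup_algebra T x -> semigroup_algebra T y ->
  lcoef h (x * y) = Psi x y.
Proof.
move=> Psi0l Psi0r PsiDl PsiDr PsiX x y Tx Ty.
suff [] : semigroup_algebra T x /\ lcoef h (x * y) = Psi x y by [].
move: x Tx; apply: semigroup_algebra_ind => [|x x' [Tx Ex] [Tx' Ex']|c m Tm].
- by split; [exact: semigroup_algebra0|rewrite mul0r lcoef0 Psi0l].
- split; first exact: semigroup_algebraD.
  rewrite mulrDl (@lcoefD T) ?Ex ?Ex' ?PsiDl //; exact: semigroup_algebraM.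
split; first exact: semigroup_algebra_term.
suff [] : semigroup_algebra T y /\
  lcoef h (kc c * xm m * y) = Psi (kc c * xm m) y by [].
have Tcm : semigroup_algebra T (kc c * xm m) by apply: semigroup_algebra_term.
move: y Ty; apply: semigroup_algebra_ind => [|y y' [Ty Ey] [Ty' Ey']|d n Tn].
- by split; [exact: semigroup_algebra0|rewrite mulr0 lcoef0 Psi0r].
- split; first exact: semigroup_algebraD.
  rewrite mulrDr (@lcoefD T) ?Ey ?Ey' ?PsiDr //; exact: semigroup_algebraM.
split; first exact: semigroup_algebra_term.
by rewrite mulrACA -(rmorphM kc) -laurent_monomialD lcoef_term PsiX.
Qed.

(** Only 0 is invertible in [T], so the constant term of a product comes from the constant terms
    alone: [lcoef 0] is evaluation at the torus-fixed point. *)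
Lemma lcoef0M x y : semigroup_algebra T x -> semigroup_algebra T y ->
  lcoef 0 (x * y) = lcoef 0 x * lcoef 0 y.
Proof.
apply: (@lcoef_mul 0 (fun x y => lcoef 0 x * lcoef 0 y)).
- by move=> y'; rewrite lcoef0 mul0r.
- by move=> x'; rewrite lcoef0 mulr0.
- by move=> x1 x2 y' T1 T2; rewrite (@lcoefD T) // mulrDl.
- by move=> x' y1 y2 T1 T2; rewrite (@lcoefD T) // mulrDr.
move=> c d m n Tm Tn; rewrite !lcoef_term mulrACA -natrM mulnb; congr (_ * (nat_of_bool _)%:R).
apply/andP/eqP => [[/eqP -> /eqP ->]|E]; first by rewrite addr0.
by have [-> ->] := irreducible_pointed Tm Tn E.
Qed.

(** An irreducible [h] is a sum in [T] only as 0 + h or h + 0; these two ways are the two terms of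
    the Leibniz rule. *)
Lemma lcoef_irreducibleM h x y : irreducible_in h -> semigroup_algebra T x ->
  semigroup_algebra T y ->
  lcoef h (x * y) = lcoef 0 x * lcoef h y + lcoef 0 y * lcoef h x.
Proof.
move=> [Th hn0 irr].
apply: (@lcoef_mul h (fun x y => lcoef 0 x * lcoef h y + lcoef 0 y * lcoef h x)).
- by move=> y'; rewrite !lcoef0 mul0r mulr0 addr0.
- by move=> x'; rewrite !lcoef0 mul0r mulr0 addr0.
- by move=> x1 x2 y' T1 T2; rewrite !(@lcoefD T) //; ring.
- by move=> x' y1 y2 T1 T2; rewrite !(@lcoefD T) //; ring.
move=> c d m n Tm Tn; rewrite !lcoef_term.
rewrite mulrACA [X in _ + X]mulrACA [d * c]mulrC -mulrDr; congr (_ * _).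
rewrite -!natrM -natrD; congr (_%:R).
have [->|mn0] := eqVneq m 0.
  by rewrite add0r [0 == h]eq_sym (negPf hn0) mul1n muln0 addn0.
have [->|nn0] := eqVneq n 0.
  by rewrite addr0 mul0n mul1n add0n.
rewrite !mul0n; case: eqP => // E.
by have [/eqP|/eqP] := irr _ _ Tm Tn (esym E); rewrite ?(negPf mn0) ?(negPf nn0).
Qed.

(* For irreducible h, the coefficient of x^h is a derivation at the torus-fixed point;
   pulled back to C[t_1, ..., t_s] these derivations are independent and combinations of
   the s partial derivatives. *)
Lemma irreducible_count q (h : 'I_q -> 'rV[int]_s) :
  injective h -> (forall a, irreducible_in (h a)) -> (q <= s)%N.
Proof.
move=> h_inj irr; have [pre preE] := iso_preimage.
pose eps p := lcoef 0 (phi p).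
pose D a p := lcoef (h a) (phi p).
have phiT := iso_mem.
have DE a p : D a p = \sum_j eps p^`M(j) * D a 'X_j.
  apply: derivation_mderiv => [p1 p2|p1 p2|c|p1 p2|c|p1 p2].
  - by rewrite /eps rmorphD (@lcoefD T).
  - by rewrite /eps rmorphM lcoef0M.
  - by rewrite /eps phiC -[kc c]mulr1 -(laurent_monomial0 R s) lcoef_term eqxx mulr1.
  - by rewrite /D rmorphD (@lcoefD T).
  - rewrite /D phiC -[kc c]mulr1 -(laurent_monomial0 R s) lcoef_term.
    by have [_ hn0 _] := irr a; rewrite eq_sym (negPf hn0) mulr0.
  - by rewrite /D /eps rmorphM lcoef_irreducibleM.
(* Evaluating the [D a] on the characters of the [h b] factors the identity matrix of size [q]
   through C^s. *)
apply: (@mulmx1_min C q s (\matrix_(a, j) eps (pre (h a))^`M(j)) (\matrix_(j, b) D b 'X_j)).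
apply/matrixP => a b; rewrite !mxE.
under eq_bigr do rewrite !mxE.
rewrite -DE /D preE; last by have [] := irr a.
by rewrite lcoef_monomial (inj_eq h_inj).
Qed.

(** A longest list of distinct irreducible elements exists by [irreducible_count] and contains them
    all. It generates [T], hence spans Z^s, so it has exactly [s] members and its matrix has an
    integral inverse; being in [T] then means having nonnegative coordinates. *)
Lemma irreducible_basis : exists2 B : 'M[int]_s, B \in unitmx &
  forall m, T m <-> forall k, 0 <= (m *m invmx B) 0 k.
Proof.
pose Q q := exists h : 'I_q -> 'rV[int]_s, injective h /\ forall a, irreducible_in (h a).
have exQ : exists q, `[< Q q >].
  by exists 0%N; apply/asboolP; exists (fun=> 0); split; case.
have leQ q : `[< Q q >] -> (q <= s)%N.
  by move=> /asboolP [h [h_inj irr]]; apply: irreducible_count h_inj irr.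
case: (ex_maxnP exQ leQ) => q /asboolP [h [h_inj irr]] qmax.
have irr_range : irreducible_in `<=` range h.
  move=> m irrm; apply: contrapT => nrange.
  have : `[< Q q.+1 >].
    apply/asboolP; exists (fun a => if unlift ord_max a is Some b then h b else m).
    split=> [a b|a]; last by case: unliftP.
    case: unliftP => [a'|] ->; case: unliftP => [b'|] -> //.
    - by move=> /h_inj ->.
    - by move=> E; case: nrange; exists a'.
    - by move=> E; case: nrange; exists b'.
  by move=> /qmax; rewrite ltnn.
have gen m : T m -> exists b, m = gsum h b.
  move=> /generated_by_irreducible mgen; apply/generatedP.
  by move: m mgen; apply: generated_min; [exact: generated0|exact: generatedD|];
    move=> m /irr_range; apply: generated_mem.
have hT b : T (gsum h b).
  apply: (big_ind T) => // j _; apply: semigroupMn => //.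
  by have [] := irr j.
pose H := \matrix_j h j.
have span m : exists w, m = w *m H.
  have [u [v [/gen [b ->] /gen [c ->] ->]]] := Tgen m.
  by exists (mrow b - mrow c); rewrite mulmxBl !gsum_mulmx.
have /choice [w wE] := fun k => span (delta_mx 0 k).
pose W := \matrix_k w k.
have WH : W *m H = 1%:M.
  by apply/row_matrixP => k; rewrite row_mul rowK -wE rowE mulmx1.
have eqs : q = s.
  by apply/eqP; rewrite eqn_leq leQ ?(mulmx1_min WH) //; apply/asboolP; exists h.
clear qmax; subst q.
have [_ Hu] := mulmx1_unit WH.
exists H => // m; split=> [/gen [b ->] k|m0].
  by rewrite gsum_mulmx mulmxK // mxE.
by rewrite -(mulmxKV Hu m) -(mrowK m0) -gsum_mulmx.
Qed.

End Isomorphism.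

End FreeNormalization.

(** * Points and tangent spaces *)

Section PointDerivation.
Context (F : comNzRingType) (p : nat).
Implicit Types (P v : 'rV[F]_p) (f h : {mpoly F[p]}) (b c : 'X_{1..p}).

Definition point_deriv P v f := \sum_(i < p) (f^`M(i)).@[P 0] * v 0 i.

Lemma point_derivD P v f h : point_deriv P v (f + h) = point_deriv P v f + point_deriv P v h.
Proof.
by rewrite -big_split; apply: eq_bigr => i _; rewrite mderivD mevalD mulrDl.
Qed.

Lemma point_derivB P v f h : point_deriv P v (f - h) = point_deriv P v f - point_deriv P v h.
Proof.
by rewrite -sumrB; apply: eq_bigr => i _; rewrite mderivB mevalB mulrBl.
Qed.

Lemma point_derivM P v f h :
  point_deriv P v (f * h) = f.@[P 0] * point_deriv P v h + h.@[P 0] * point_deriv P v f.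
Proof.
rewrite !mulr_sumr -big_split; apply: eq_bigr => i _ /=.
by rewrite mderivM mevalD !mevalM; ring.
Qed.

Lemma point_derivXD P v b c : point_deriv P v 'X_[b + c] =
  'X_[b].@[P 0] * point_deriv P v 'X_[c] + 'X_[c].@[P 0] * point_deriv P v 'X_[b].
Proof. by rewrite mpolyXD point_derivM. Qed.

Lemma point_deriv1 P v : point_deriv P v 'X_[0%MM] = 0.
Proof.
by rewrite mpolyX0 -mpolyC1; apply: big1 => i _; rewrite mderivC meval0 mul0r.
Qed.

Lemma point_derivX P v j : point_deriv P v 'X_j = v 0 j.
Proof.
rewrite /point_deriv (bigD1 j) //= big1 => [|k nkj]; rewrite mderivX mnm1E.
  have -> : (U_(j) - U_(j))%MM = 0%MM :> 'X_{1..p} by apply/mnmP => l; rewrite mnmBE subnn mnm0E.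
  by rewrite eqxx scale1r mpolyX0 meval1 mul1r addr0.
by rewrite eq_sym (negPf nkj) scale0r meval0 mul0r.
Qed.

Lemma point_deriv_lin P v w (a : F) f :
  point_deriv P (a *: v + w) f = a * point_deriv P v f + point_deriv P w f.
Proof.
rewrite mulr_sumr -big_split; apply: eq_bigr => i _ /=.
by rewrite !mxE; ring.
Qed.

Lemma point_derivXMn P v b k : point_deriv P v 'X_[b *+ k] =
  k%:R * 'X_[b].@[P 0] ^+ k.-1 * point_deriv P v 'X_[b].
Proof.
elim: k => [|k IH]; first by rewrite mulm0n point_deriv1 !mul0r.
rewrite mulmS point_derivXD IH -mpolyXn rmorphXn /= -natr1.
by case: k {IH} => [|k]; rewrite ?expr0 ?exprS; ring.
Qed.

Lemma mevalXD P b c : 'X_[b + c].@[P 0] = 'X_[b].@[P 0] * 'X_[c].@[P 0].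
Proof. by rewrite mpolyXD mevalM. Qed.

Lemma mevalXMn P b k : 'X_[b *+ k].@[P 0] = 'X_[b].@[P 0] ^+ k.
Proof. by rewrite -mpolyXn rmorphXn. Qed.

End PointDerivation.

Section ToricVariety.
Context (R : realType) (s p : nat) (g : 'I_p -> 'rV[int]_s).
Local Notation C := R[i].
Implicit Types (P v : 'rV[C]_p) (b c : 'X_{1..p}).

Lemma gsum_parts (a : 'rV[int]_p) :
  \sum_(i < p) a 0 i *: g i = gsum g (pos_part a) - gsum g (neg_part a).
Proof.
rewrite -sumrB; apply: eq_bigr => i _; rewrite !mnmE mxE.
apply/rowP => k; rewrite !mxE !mulmxnE; move: (a 0 i) (g i 0 k) => x y.
by rewrite -!(mulr_natr y) !natz -mulrBr mulrC; congr (_ * _); lia.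
Qed.

(** The given generators of I_S are binomials with disjoint supports. Dividing by the common factor
    with exponents min(b_i, c_i) brings any binomial to that shape. *)
Lemma toric_ideal_binomial b c : gsum g b = gsum g c ->
  toric_ideal (R := R) g ('X_[b] - 'X_[c]).
Proof.
move=> E; pose a := mrow b - mrow c; pose m := [multinom minn (b i) (c i) | i < p].
have Eb : b = (m + pos_part a)%MM.
  by apply/mnmP => i; rewrite mnmDE !mnmE !mxE; lia.
have Ec : c = (m + neg_part a)%MM.
  by apply/mnmP => i; rewrite mnmDE !mnmE !mxE; lia.
exists 1%N, (fun=> 'X_[m]), (fun=> 'X_[pos_part a] - 'X_[neg_part a]); split=> //.
  move=> _; exists a => //=; rewrite gsum_parts.
  by apply: (addrI (gsum g m)); rewrite addr0 addrA -gsumD -Eb E {1}Ec gsumD addrK.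
by rewrite big_ord1 {1}Eb {1}Ec !mpolyXD -mulrBr.
Qed.

Lemma toric_ideal_min (Q : {mpoly C[p]} -> Prop) :
  Q 0 -> (forall f h, Q f -> Q h -> Q (f + h)) ->
  (forall f b c, gsum g b = gsum g c -> Q (f * ('X_[b] - 'X_[c]))) ->
  forall f, toric_ideal g f -> Q f.
Proof.
move=> Q0 QD QB _ [k [a [v [_ vB ->]]]]; apply: big_ind => // e _.
have [d /= dE <-] := vB e; apply: QB.
by apply/eqP; rewrite -subr_eq0 -gsum_parts dE.
Qed.

(** Points of X(S) are multiplicative functions on S: the value of a monomial depends only on the
    element of S it represents. *)
Lemma toric_varietyP P : toric_variety g P <->
  forall b c, gsum g b = gsum g c -> 'X_[b].@[P 0] = 'X_[c].@[P 0].
Proof.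
split=> [XP b c /toric_ideal_binomial/XP|XP f].
  by rewrite mevalB => /eqP; rewrite subr_eq0 => /eqP.
move: f; apply: toric_ideal_min => [|f h fP hP|f b c E].
- by rewrite meval0.
- by rewrite mevalD fP hP addr0.
- by rewrite mevalM mevalB (XP _ _ E) subrr mulr0.
Qed.

(** In the derivative of f (x^b - x^c) at a point of X(S) the term differentiating f vanishes, so
    only the binomials impose conditions. *)
Lemma tangent_spaceP P v : toric_variety g P -> tangent_space g P v <->
  forall b c, gsum g b = gsum g c -> point_deriv P v 'X_[b] = point_deriv P v 'X_[c].
Proof.
move=> XP; split=> [TP b c /toric_ideal_binomial/TP|TP f If].
  by rewrite -/(point_deriv P v _) point_derivB => /eqP; rewrite subr_eq0 => /eqP.
rewrite -/(point_deriv P v f); move: f If.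
apply: toric_ideal_min => [|f h fP hP|f b c E].
- by rewrite -(subrr 'X_[0%MM]) point_derivB subrr.
- by rewrite point_derivD fP hP addr0.
rewrite point_derivM point_derivB (TP _ _ E) subrr mulr0 add0r mevalB.
by rewrite ((toric_varietyP P).1 XP _ _ E) subrr mul0r.
Qed.

End ToricVariety.

Section Dimension.
Context (F : fieldType) (n : nat).
Implicit Types (W : set 'rV[F]_n).

Lemma dim_rV q : \dim {: 'rV[F]_q} = q.
Proof. by rewrite dimvf /dim /= mul1n. Qed.

Lemma has_dim_row_free q (A : 'M[F]_(q, n)) W : row_free A ->
  (forall v, W v <-> exists w, v = w *m A) -> has_dim W q.
Proof.
move=> Afree WE; pose f := linfun (mulmxr A : 'rV[F]_q -> 'rV[F]_n).
exists (f @: fullv)%VS => [|v].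
  rewrite limg_dim_eq ?dim_rV //; apply/eqP; rewrite -subv0; apply/subvP => w.
  rewrite memv_cap memv_ker lfunE /= memv0 => /andP [_ /eqP wA].
  by apply/eqP/(row_free_inj Afree); rewrite wA mul0mx.
rewrite WE; split=> [/memv_imgP [w _ ->]|[w ->]]; first by exists w; rewrite lfunE.
by apply/memv_imgP; exists w; rewrite ?memvf // lfunE.
Qed.

Lemma has_dim_ge q d (A : 'M[F]_(q, n)) W : row_free A -> has_dim W d ->
  (forall w, W (w *m A)) -> (q <= d)%N.
Proof.
move=> Afree [V <- VW] WA; pose f := linfun (mulmxr A : 'rV[F]_q -> 'rV[F]_n).
have <- : \dim (f @: fullv)%VS = q.
  rewrite limg_dim_eq ?dim_rV //; apply/eqP; rewrite -subv0; apply/subvP => w.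
  rewrite memv_cap memv_ker lfunE /= memv0 => /andP [_ /eqP wA].
  by apply/eqP/(row_free_inj Afree); rewrite wA mul0mx.
by apply/dimvS/subvP => _ /memv_imgP [w _ ->]; apply/VW; rewrite lfunE /=; apply: WA.
Qed.

End Dimension.

(** * Smooth points through monomial charts *)

Section SmoothPoint.
Context (R : realType) (s p : nat) (n : 'I_p -> 'X_{1..s}).
Local Notation C := R[i].
Local Notation g := (fun j => mrow (n j)).

Definition msum (b : 'X_{1..p}) : 'X_{1..s} := (\sum_j n j *+ b j)%MM.

Lemma msumD b c : msum (b + c)%MM = (msum b + msum c)%MM.
Proof.
by apply/mnmP => k; rewrite mnmDE !mnm_sumE -big_split; apply: eq_bigr => j _;
  rewrite !mulmnE mnmDE mulnDr.
Qed.

Lemma msum0 : msum 0%MM = 0%MM.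
Proof.
by apply/mnmP => k; rewrite mnm_sumE mnm0E big1 // => j _; rewrite mulmnE mnm0E muln0.
Qed.

Lemma msumU j : msum U_(j)%MM = n j.
Proof.
apply/mnmP => k; rewrite mnm_sumE (bigD1 j) //= mulmnE mnm1E eqxx muln1 big1 ?addn0 //.
by move=> e ne; rewrite mulmnE mnm1E eq_sym (negPf ne) muln0.
Qed.

Lemma msumMn b k : msum (b *+ k)%MM = (msum b *+ k)%MM.
Proof.
elim: k => [|k IH]; first by rewrite !mulm0n msum0.
by rewrite !mulmS msumD IH.
Qed.

Lemma msum_sum I (r : seq I) (b : I -> 'X_{1..p}) :
  msum (\sum_(e <- r) b e)%MM = (\sum_(e <- r) msum (b e))%MM.
Proof. exact: (big_morph _ msumD msum0). Qed.

Lemma gsum_mrow b : gsum g b = mrow (msum b).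
Proof.
elim/multinom_ind: b => [|j b IH]; first by rewrite gsum0 msum0 mrow0.
by rewrite gsumD gsumU msumD msumU mrowD IH.
Qed.

Lemma gsum_mrow_eq b c : gsum g b = gsum g c <-> msum b = msum c.
Proof. by rewrite !gsum_mrow; split=> [/mrow_inj|->]. Qed.

(* P is the image of a point tau under the monomial parametrization of X(S), whose
   differential identifies C^s with the tangent space. *)
Lemma smooth_point (P : 'rV[C]_p) (r : 'X_{1..p}) (N : 'I_s -> nat)
    (cb : 'I_s -> 'X_{1..p}) :
  toric_variety g P -> 'X_[r].@[P 0] != 0 ->
  (forall k, msum (cb k) = (U_(k) + msum r *+ N k)%MM) -> nonsingular_at g P.
Proof.
move=> XP r0 cbE.
pose ev b : C := 'X_[b].@[P 0].
have evE b c : msum b = msum c -> ev b = ev c.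
  by move=> E; apply: (toric_varietyP _ _).1 XP _ _ _; apply/gsum_mrow_eq.
(* In the group, [U_(k)] is [msum (cb k)] minus [N k] times [msum r]. Expanding [msum b] along the
   [U_(k)] gives [comb b], and [M b] counts the copies of [r] to be compensated. *)
pose M b := (\sum_k N k * msum b k)%N.
pose comb b := (\sum_k cb k *+ msum b k)%MM.
have combE b : msum (b + r *+ M b)%MM = msum (comb b).
  rewrite msumD msum_sum msumMn; apply/mnmP => k.
  rewrite mnmDE mnm_sumE mulmnE /M big_distrr /=.
  under [in RHS]eq_bigr => l _ do rewrite msumMn cbE mulmnE mnmDE mulmnE mnm1E mulnDl.
  rewrite big_split /=; congr (_ + _)%N; last by apply: eq_bigr => l _; rewrite mulnA.
  rewrite (bigD1 k) //= eqxx mul1n big1 ?addn0 // => l /negPf -> //.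
(* The value at [P] of the character [U_(k)], defined because [r] is invertible at [P]. *)
pose tau : 'rV[C]_s := \row_k (ev (cb k) / ev r ^+ N k).
have evMn b k : ev (b *+ k)%MM = ev b ^+ k by apply: mevalXMn.
have evD b c : ev (b + c)%MM = ev b * ev c by apply: mevalXD.
have tauE b : ev b = 'X_[msum b].@[tau 0].
  have rM0 : ev r ^+ M b != 0 by rewrite expf_neq0.
  apply: (mulIf rM0); rewrite -evMn -evD (evE _ _ (combE b)) evMn /M expr_sum.
  rewrite mevalX -big_split /= /comb (big_morph ev evD (id1 := 1)).
    apply: eq_bigr => k _; rewrite evMn mxE exprM expr_div_n divfK //.
    by rewrite !expf_neq0.
  by rewrite /ev mpolyX0 meval1.
(* The differential at [tau] of the monomial parametrization. *)
pose V (w : 'rV[C]_s) : 'rV[C]_p := \row_j point_deriv tau w 'X_[n j].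
have dV w b : point_deriv P (V w) 'X_[b] = point_deriv tau w 'X_[msum b].
  elim/multinom_ind: b => [|j b IH]; first by rewrite msum0 !point_deriv1.
  rewrite point_derivXD IH msumD msumU point_derivXD point_derivX mxE.
  by rewrite -msumU -!tauE.
have TV w : tangent_space g P (V w).
  by apply/(tangent_spaceP _ XP) => b c /gsum_mrow_eq E; rewrite !dV E.
have derE v b c : tangent_space g P v -> msum b = msum c ->
    point_deriv P v 'X_[b] = point_deriv P v 'X_[c].
  by move=> /(tangent_spaceP _ XP) TP /gsum_mrow_eq /TP.
have der0 v : tangent_space g P v -> (forall k, point_deriv P v 'X_[cb k] = 0) -> v = 0.
  move=> Tv v0.
  have comb0 b : point_deriv P v 'X_[comb b] = 0.
    apply: (big_ind (fun c => point_deriv P v 'X_[c] = 0)) => [|b1 b2 E1 E2|k _].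
    - exact: point_deriv1.
    - by rewrite point_derivXD E1 E2 !mulr0 addr0.
    - by rewrite point_derivXMn v0 mulr0.
  (* Applied to [r] itself, the relation expresses a positive power of x^r through the [cb k]; as C
     has characteristic 0, the derivative of x^r vanishes. *)
  have dr0 : point_deriv P v 'X_[r] = 0.
    have := comb0 r; rewrite -(derE v _ _ Tv (combE r)) -mulmS point_derivXMn => /eqP.
    by rewrite !mulf_eq0 pnatr_eq0 /= expf_eq0 (negPf r0) andbF => /eqP.
  apply/rowP => j; rewrite mxE -(point_derivX P v j).
  have := comb0 U_(j)%MM; rewrite -(derE v _ _ Tv (combE _)) point_derivXD.
  rewrite point_derivXMn dr0 !mulr0 add0r => /eqP.
  by rewrite mulf_eq0 [X in X || _](negPf _) => [/eqP|]; rewrite // -/(ev _) evMn expf_neq0.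
have V0 w : V w = 0 -> w = 0.
  move=> Vw0; have d0 b : point_deriv tau w 'X_[msum b] = 0.
    by rewrite -dV Vw0; apply: big1 => i _; rewrite mxE mulr0.
  apply/rowP => k; rewrite mxE.
  have := d0 (cb k); rewrite cbE point_derivXD -msumMn d0 mulr0 add0r point_derivX => /eqP.
  by rewrite mulf_eq0 -tauE evMn expf_eq0 (negPf r0) andbF => /eqP.
pose A : 'M[C]_(s, p) := \matrix_(k, j) V (delta_mx 0 k) 0 j.
have VA w : V w = w *m A.
  apply/rowP => j; rewrite !mxE /point_deriv.
  under [in RHS]eq_bigr => k _ do rewrite !mxE mulr_sumr.
  rewrite exchange_big /=; apply: eq_bigr => i _.
  rewrite (bigD1 i) //= big1 => [|k nki]; rewrite mxE /=.
    by rewrite !eqxx mulr1 addr0 mulrC.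
  by rewrite eq_sym (negPf nki) !mulr0.
apply: (@has_dim_row_free _ _ _ A).
  by apply: inj_row_free => w wA; apply: V0; rewrite VA.
move=> v; split=> [Tv|[w ->]]; last by rewrite -VA.
(* [Z] collects the differentials of the x^(cb k) and is injective on the tangent space. So [A *m Z]
   is invertible, and each tangent vector has the same image under [Z] as some [w *m A]. *)
pose Z : 'M[C]_(p, s) := \matrix_(j, k) ('X_[cb k])^`M(j).@[P 0].
have ZE u k : point_deriv P u 'X_[cb k] = (u *m Z) 0 k.
  by rewrite mxE; apply: eq_bigr => j _; rewrite mxE mulrC.
have ker0 u : tangent_space g P u -> u *m Z = 0 -> u = 0.
  by move=> Tu uZ; apply: der0 => // k; rewrite ZE uZ mxE.
have AZ : A *m Z \in unitmx.
  rewrite -row_free_unit; apply: inj_row_free => w; rewrite mulmxA => /ker0 wA.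
  by apply: V0; rewrite VA wA // -VA.
have [w wE] : exists w, w *m A *m Z = v *m Z.
  by exists (v *m Z *m invmx (A *m Z)); rewrite -[LHS]mulmxA mulmxKV.
exists w.
apply/eqP; rewrite -subr_eq0 addrC -scaleN1r; apply/eqP/ker0.
  apply/(tangent_spaceP _ XP) => b c /gsum_mrow_eq E; rewrite -VA !point_deriv_lin.
  by rewrite (derE _ _ _ (TV w) E) (derE _ _ _ Tv E).
by rewrite mulmxDl -scalemxAl wE scaleN1r addNr.
Qed.

End SmoothPoint.

(** * Smoothness along a ray *)

Section RayStructure.
Context (R : realType) (s p : nat) (n : 'I_p -> 'X_{1..s}).
Local Notation C := R[i].
Local Notation g := (fun j => mrow (n j)).
Implicit Types (m u v : 'X_{1..s}).

Definition in_semigroup : set 'X_{1..s} := [set m | exists b, m = msum n b].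
Local Notation S := in_semigroup.

Lemma in_semigroup0 : S 0%MM. Proof. by exists 0%MM; rewrite msum0. Qed.

Lemma in_semigroupD u v : S u -> S v -> S (u + v)%MM.
Proof. by move=> [b ->] [c ->]; exists (b + c)%MM; rewrite msumD. Qed.

Lemma in_semigroup_gen j : S (n j).
Proof. by exists U_(j)%MM; rewrite msumU. Qed.

(** * Points and tangent vectors as functions on the semigroup *)

Section Characters.
Context (chi D : 'X_{1..s} -> C).
Hypothesis chi0 : chi 0%MM = 1.
Hypothesis chiD : forall u v, S u -> S v -> chi (u + v)%MM = chi u * chi v.
Hypothesis D0 : D 0%MM = 0.
Hypothesis DD : forall u v, S u -> S v -> D (u + v)%MM = chi u * D v + chi v * D u.
Local Notation P := (\row_j chi (n j)).

Lemma meval_char b : 'X_[b].@[(P : 'rV[C]_p) 0] = chi (msum n b).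
Proof.
elim/multinom_ind: b => [|j b IH]; first by rewrite mpolyX0 meval1 msum0.
rewrite mevalXD mevalXU mxE IH msumD msumU chiD //; first exact: in_semigroup_gen.
by exists b.
Qed.

Lemma variety_char : toric_variety g P.
Proof. by apply/toric_varietyP => b c /gsum_mrow_eq E; rewrite !meval_char E. Qed.

Lemma point_deriv_char b :
  point_deriv P (\row_j D (n j)) 'X_[b] = D (msum n b).
Proof.
elim/multinom_ind: b => [|j b IH]; first by rewrite point_deriv1 msum0.
rewrite point_derivXD mevalXU point_derivX meval_char IH msumD msumU !mxE DD //.
  exact: in_semigroup_gen.
by exists b.
Qed.

Lemma tangent_char : tangent_space g P (\row_j D (n j)).
Proof.
apply/(tangent_spaceP _ variety_char) => b c /gsum_mrow_eq E.
by rewrite !point_deriv_char E.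
Qed.

End Characters.

Section Ray.
Context (i : 'I_s).

Definition on_ray m := [forall k, (k != i) ==> (m k == 0%N)].

Lemma on_rayP m : reflect (forall k, k != i -> m k = 0%N) (on_ray m).
Proof.
apply: (iffP forallP) => [H k ki|H k]; last by apply/implyP => /H ->.
by have /implyP /(_ ki) /eqP := H k.
Qed.

Lemma on_rayD u v : on_ray (u + v)%MM = on_ray u && on_ray v.
Proof.
apply/on_rayP/andP => [H|[/on_rayP Hu /on_rayP Hv] k ki]; last by rewrite mnmDE Hu ?Hv.
by split; apply/on_rayP => k /H; rewrite mnmDE; lia.
Qed.

Lemma on_ray0 : on_ray 0%MM. Proof. by apply/on_rayP => k _; rewrite mnm0E. Qed.

Context (t : C) (t0 : t != 0).

(** The point of the i-th axis with parameter [t]. Extension by zero stays multiplicative because a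
    sum lies on the ray only when both summands do. *)
Definition ray_char m : C := if on_ray m then t ^+ m i else 0.

Definition ray_point : 'rV[C]_p := \row_j ray_char (n j).

Lemma ray_char0 : ray_char 0%MM = 1.
Proof. by rewrite /ray_char on_ray0 mnm0E. Qed.

Lemma ray_charD u v : S u -> S v -> ray_char (u + v)%MM = ray_char u * ray_char v.
Proof.
move=> _ _; rewrite /ray_char on_rayD.
by case: on_ray; case: on_ray; rewrite ?mul0r ?mulr0 // mnmDE exprD.
Qed.

(* m and h agree modulo the group generated by the elements of S on the ray. *)
Definition near m h := exists u v,
  [/\ S u, S v, on_ray u, on_ray v & (m + u = h + v)%MM].

Lemma near_off_ray m h : near m h -> ~~ on_ray h -> ~~ on_ray m.
Proof.
move=> [u [v [_ _ ru rv]]] /(congr1 on_ray); rewrite !on_rayD ru rv !andbT.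
by move=> ->.
Qed.

Lemma near_coord m h k : near m h -> k != i -> m k = h k.
Proof.
move=> [u [v [_ _ /on_rayP ru /on_rayP rv]]] E ki.
by have := congr1 (fun x : 'X_{1..s} => x k) E; rewrite !mnmDE ru // rv // !addn0.
Qed.

Lemma near_refl m : near m m.
Proof. by exists 0%MM, 0%MM; split=> //; (exact: in_semigroup0 || exact: on_ray0). Qed.

Lemma near_addl u m h : S u -> on_ray u -> near (u + m)%MM h <-> near m h.
Proof.
move=> Su ru; split=> -[v [w [Sv Sw rv rw E]]].
  exists (u + v)%MM, w; split=> //; [exact: in_semigroupD|by rewrite on_rayD ru|].
  by rewrite addmA [(m + u)%MM]addmC.
exists v, (u + w)%MM; split=> //; [exact: in_semigroupD|by rewrite on_rayD ru|].
by rewrite -addmA E addmA [(u + h)%MM]addmC addmA.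
Qed.

(* h represents an irreducible element of the localization of S along the ray. *)
Definition ray_irreducible h := [/\ S h, ~~ on_ray h &
  forall u v, S u -> S v -> ~~ on_ray u -> ~~ on_ray v -> ~ near (u + v)%MM h].

(** The tangent direction dual to the class of [h] in the localization; moving within the class by
    elements of the ray multiplies by powers of [t]. *)
Definition near_deriv h m : C := if `[< near m h >] then t ^+ m i else 0.

Lemma near_deriv0 h : ray_irreducible h -> near_deriv h 0%MM = 0.
Proof.
move=> [_ nh _]; rewrite /near_deriv; case: asboolP => // /near_off_ray /(_ nh).
by rewrite on_ray0.
Qed.

(** A summand on the ray only rescales by a power of [t]. If both summands are off the ray, both
    values of [ray_char] vanish, and irreducibility keeps the sum out of the class of [h]. *)
Lemma near_derivD h u v : ray_irreducible h -> S u -> S v ->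
  near_deriv h (u + v)%MM = ray_char u * near_deriv h v + ray_char v * near_deriv h u.
Proof.
move=> [Sh nh irr] Su Sv; rewrite /near_deriv /ray_char.
have nn m : on_ray m -> `[< near m h >] = false.
  by move=> rm; apply/asboolP => /near_off_ray /(_ nh); rewrite rm.
have [ru|nu] := boolP (on_ray u); have [rv|nv] := boolP (on_ray v).
- by rewrite !nn // ?on_rayD ?ru //; ring.
- rewrite (nn u) // mul0r addr0 (asbool_equiv_eq (near_addl v h Su ru)).
  by case: asbool; rewrite ?mulr0 // mnmDE exprD.
- rewrite (nn v) // mulr0 add0r addmC (asbool_equiv_eq (near_addl u h Sv rv)).
  by case: asbool; rewrite ?mulr0 // mnmDE exprD.
by rewrite asboolF ?mul0r ?addr0 //; apply: irr.
Qed.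

(** The Euler derivation t d/dt along the ray. *)
Definition ray_deriv m : C := if on_ray m then (m i)%:R * t ^+ m i else 0.

Lemma ray_deriv0 : ray_deriv 0%MM = 0.
Proof. by rewrite /ray_deriv on_ray0 mnm0E mul0r. Qed.

Lemma ray_derivD u v : S u -> S v ->
  ray_deriv (u + v)%MM = ray_char u * ray_deriv v + ray_char v * ray_deriv u.
Proof.
move=> _ _; rewrite /ray_deriv /ray_char on_rayD.
by case: on_ray; case: on_ray => /=; rewrite ?mnmDE ?natrD ?exprD; ring.
Qed.

Lemma near_deriv_refl h : near_deriv h h != 0.
Proof. by rewrite /near_deriv asboolT ?expf_neq0 //; apply: near_refl. Qed.

(* The localization of S along the ray has at most s - 1 irreducibles when the
   tangent space has dimension s: the derivations attached to further ones would be
   independent. *)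
Lemma nonsingular_irreducibles (h : 'I_s -> 'X_{1..s}) m :
  (exists2 q, (0 < q)%N & S (U_(i) *+ q)%MM) -> nonsingular_at g ray_point ->
  (forall k, k != i -> ray_irreducible (h k)) -> ray_irreducible m ->
  (forall k l, k != i -> l != i -> near (h k) (h l) -> k = l) ->
  exists2 k, k != i & near m (h k) \/ near (h k) m.
Proof.
move=> [q q0 Sq] ns irr irrm sep; apply: contrapT => nex.
have nmh k : k != i -> ~ near m (h k) by move=> ki H; apply: nex; exists k => //; left.
have nhm k : k != i -> ~ near (h k) m by move=> ki H; apply: nex; exists k => //; right.
(* Here are s + 1 derivations [E a] and test elements [pt a]: slot [i] belongs to the ray, the slots
   k <> i to the [h k], and [None] to [m]. The matrix of values is diagonal with nonzero diagonal,
   so the tangent vectors are independent. *)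
pose pt (a : option 'I_s) := if a is Some k then
  if k == i then (U_(i) *+ q)%MM else h k else m.
pose E (a : option 'I_s) := if a is Some k then
  if k == i then ray_deriv else near_deriv (h k) else near_deriv m.
have E0 a : E a 0%MM = 0.
  case: a => [k|] /=; last exact: near_deriv0.
  by case: eqVneq => [_|/irr/near_deriv0//]; apply: ray_deriv0.
have ED a u v : S u -> S v -> E a (u + v)%MM = ray_char u * E a v + ray_char v * E a u.
  case: a => [k|] /=; last exact: near_derivD.
  by case: eqVneq => [_|/irr ?]; [apply: ray_derivD|apply: near_derivD].
have Spt a : S (pt a).
  case: a => [k|] /=; last by case: irrm.
  by case: eqVneq => [_//|/irr []].
have rq : on_ray (U_(i) *+ q)%MM.
  by apply/on_rayP => k ki; rewrite mulmnE mnm1E eq_sym (negPf ki).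
have nrq x : ray_irreducible x -> near_deriv x (U_(i) *+ q)%MM = 0.
  by move=> [_ nx _]; rewrite /near_deriv asboolF // => /near_off_ray /(_ nx); rewrite rq.
have nrd x : ray_irreducible x -> ray_deriv x = 0.
  by move=> [_ nx _]; rewrite /ray_deriv (negPf nx).
have Ept a b : a != b -> E a (pt b) = 0.
  case: a => [k|]; case: b => [l|] //=; last 2 first.
  - by move=> _; case: eqVneq => [_|ki]; [apply: nrd|rewrite /near_deriv asboolF //; apply: nmh].
  - by move=> _; case: eqVneq => [_|li]; [apply: nrq|rewrite /near_deriv asboolF //; apply: nhm].
  move=> nkl; have {}nkl : k != l by apply: contraNneq nkl => ->.
  case: (eqVneq k i) => [ki|ki]; case: (eqVneq l i) => [li|li].
  - by rewrite ki li eqxx in nkl.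
  - exact/nrd/irr.
  - exact/nrq/irr.
  - rewrite /near_deriv asboolF // => /sep E1; rewrite E1 ?eqxx // in nkl.
have Eptn a : E a (pt a) != 0.
  case: a => [k|]; rewrite /E /pt; last exact: near_deriv_refl.
  case: (eqVneq k i) => [_|_]; last exact: near_deriv_refl.
  rewrite /ray_deriv rq mulf_neq0 ?expf_neq0 //.
  by rewrite mulmnE mnm1E eqxx mul1n pnatr_eq0 -lt0n.
pose opt (a : 'I_s.+1) := unlift ord_max a.
pose A : 'M[C]_(s.+1, p) := \matrix_(a, j) E (opt a) (n j).
have wAE w : w *m A = \row_j (\sum_a w 0 a * E (opt a) (n j)).
  by apply/rowP => j; rewrite !mxE; apply: eq_bigr => a _; rewrite mxE.
pose Ew (w : 'rV[C]_s.+1) (x : 'X_{1..s}) : C := \sum_a w 0 a * E (opt a) x.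
have Ew0 w : Ew w 0%MM = 0 by apply: big1 => a _; rewrite E0 mulr0.
have EwD w u v : S u -> S v -> Ew w (u + v)%MM = ray_char u * Ew w v + ray_char v * Ew w u.
  move=> Su Sv; rewrite !mulr_sumr -big_split; apply: eq_bigr => a _ /=.
  by rewrite ED //; ring.
have Afree : row_free A.
  apply: inj_row_free => w wA0; apply/rowP => a; rewrite [RHS]mxE.
  have [b bE] := Spt (opt a).
  have := point_deriv_char ray_char0 ray_charD (Ew0 w) (EwD w) b.
  rewrite -/(Ew w) -wAE wA0 -bE /Ew (bigD1 a) //= big1 => [|c ca]; last first.
    rewrite Ept ?mulr0 //; apply: contraNneq ca; rewrite /opt.
    by case: unliftP => [c' ->|->]; case: unliftP => [a' ->|->] // [->].
  rewrite addr0 => /esym/eqP; rewrite /point_deriv big1 => [|l _]; last by rewrite mxE mulr0.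
  by rewrite mulf_eq0 (negPf (Eptn _)) orbF => /eqP.
have /(has_dim_ge Afree) := ns => /(_ _) geS.
suff /geS : forall w, tangent_space g ray_point (w *m A) by rewrite ltnn.
by move=> w; rewrite wAE; apply: (tangent_char ray_char0 ray_charD (Ew0 w) (EwD w)).
Qed.

End Ray.

End RayStructure.

(** A generator equal to 0 would make its coordinate constantly 1 on X(S). *)
Lemma variety_origin_neq0 (R : realType) s p (n : 'I_p -> 'X_{1..s}) :
  toric_variety (fun j => mrow (n j)) (0 : 'rV[R[i]]_p) -> forall j, n j != 0%MM.
Proof.
move=> X0 j; apply/eqP => nj.
have : 'X_[U_(j)].@[(0 : 'rV[R[i]]_p) 0] = 'X_[0%MM].@[(0 : 'rV[R[i]]_p) 0].
  apply: (toric_varietyP _ _).1 X0 _ _ _; rewrite gsumU gsum0 nj.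
  exact: mrow0.
by rewrite mevalXU mpolyX0 meval1 mxE => /esym/eqP; rewrite oner_eq0.
Qed.

(** * Structure of the semigroup along a smooth axis *)

Section LocalStructure.
Context (R : realType) (s p : nat) (n : 'I_p -> 'X_{1..s}).
Local Notation C := R[i].
Local Notation g := (fun j => mrow (n j)).
Local Notation S := (in_semigroup n).
Implicit Types (m u v : 'X_{1..s}).
Hypothesis multiples : forall k, exists2 q, (0 < q)%N & S (U_(k) *+ q)%MM.
Hypothesis Sgroup : forall x, exists u v, [/\ S u, S v & x = mrow u - mrow v].

Section Ray.
Context (i : 'I_s).

(** Supplies, for each other axis, a candidate irreducible of the localization: an element of the
    plane of [i] and [k], off the i-th axis, of least k-th coordinate. *)
Lemma plane_minimal k : k != i -> exists m, [/\ S m, (0 < m k)%N,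
  forall l, l != i -> l != k -> m l = 0%N &
  forall m', S m' -> (0 < m' k)%N -> (forall l, l != i -> l != k -> m' l = 0%N) ->
    (m k <= m' k)%N].
Proof.
move=> ki; have [q q0 Sq] := multiples k.
pose Q d := `[< exists m, [/\ S m, (0 < m k)%N,
  forall l, l != i -> l != k -> m l = 0%N & m k = d] >].
have exQ : exists d, Q d.
  exists q; apply/asboolP; exists (U_(k) *+ q)%MM.
  split=> // [|l li lk|]; rewrite mulmnE mnm1E ?eqxx ?mul1n //.
  by rewrite eq_sym (negPf lk).
case: (ex_minnP exQ) => d /asboolP [m [Sm m0 ml <-]] dmin.
exists m; split=> // m' Sm' m'0 m'l; apply: dmin.
by apply/asboolP; exists m'.
Qed.

(** The s - 1 elements of [plane_minimal] are irreducible in distinct classes, so smoothness leaves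
    no other class. Hence these elements and those on the ray span Z^s: the k-th coordinate of U_k
    forces [h k k] = 1, and U_i must be a difference of elements on the ray. *)
Lemma ray_structure (t : C) : t != 0 -> nonsingular_at g (ray_point n i t) ->
  (forall k, k != i -> exists a, S (U_(i) *+ a + U_(k))%MM) /\
  (exists u v, [/\ S u, S v, on_ray i u, on_ray i v & u i = (v i).+1]).
Proof.
move=> t0 ns.
have /choice [h hP] : forall k, exists m, k != i -> [/\ S m, (0 < m k)%N,
  forall l, l != i -> l != k -> m l = 0%N &
  forall m', S m' -> (0 < m' k)%N -> (forall l, l != i -> l != k -> m' l = 0%N) ->
    (m k <= m' k)%N].
  move=> k.
  by have [->|/plane_minimal [m mP]] := eqVneq k i; [exists 0%MM|exists m].
have off k : k != i -> ~~ on_ray i (h k).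
  by move=> ki; apply/on_rayP => /(_ k ki); have [_ + _ _] := hP k ki; lia.
have offP m : ~~ on_ray i m -> exists2 l, l != i & (0 < m l)%N.
  by rewrite negb_forall => /existsP [l]; rewrite negb_imply -lt0n => /andP []; exists l.
(* Both summands of an element near [h k] lie in the plane of [i] and [k], off the axis, and each
   would have a k-th coordinate below the minimum. *)
have hirr k : k != i -> ray_irreducible n i (h k).
  move=> ki; have [Sh hk hl hmin] := hP k ki; split=> // [|u v Su Sv nu nv nr]; first exact: off.
  have c l : l != i -> (u l + v l = h k l)%N by move=> li; rewrite -mnmDE (near_coord nr).
  have plane w : ~~ on_ray i w -> (forall l, l != i -> w l <= h k l)%N ->
      (0 < w k)%N /\ forall l, l != i -> l != k -> w l = 0%N.
    move=> /offP [l li wl] wh; split; last first.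
      by move=> l' l'i l'k; have := wh l' l'i; rewrite hl //; lia.
    have [<-//|lk] := eqVneq l k.
    by have := wh l li; rewrite hl //; lia.
  have [uk upl] := plane u nu (fun l li => leq_trans (leq_addr _ _) (eq_leq (c l li))).
  have [vk vpl] := plane v nv (fun l li => leq_trans (leq_addl _ _) (eq_leq (c l li))).
  by have := hmin u Su uk upl; have := c k ki; lia.
have hsep k l : k != i -> l != i -> near n i (h k) (h l) -> k = l.
  move=> ki li nr; apply/eqP; apply: contraT => kl.
  have [_ hk _ _] := hP k ki; have [_ _ hl _] := hP l li.
  by have := near_coord nr ki; rewrite (hl k) //; lia.
pose L x := exists (u v : 'X_{1..s}) (cf : 'I_s -> int), [/\ S u, S v, on_ray i u, on_ray i v &
  x = mrow u - mrow v + \sum_(k | k != i) cf k *: mrow (h k)].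
have S0 := in_semigroup0 n; have SD := @in_semigroupD _ _ n.
have LD x y : L x -> L y -> L (x + y).
  move=> [u [v [c [Su Sv ru rv ->]]]] [u' [v' [c' [Su' Sv' ru' rv' ->]]]].
  exists (u + u')%MM, (v + v')%MM, (fun k => c k + c' k); split; try exact: SD.
  - by rewrite on_rayD ru.
  - by rewrite on_rayD rv.
  rewrite !mrowD opprD addrACA [mrow u + mrow u' + _]addrACA; congr (_ + _).
  by rewrite -big_split; apply: eq_bigr => k _; rewrite scalerDl.
have LN x : L x -> L (- x).
  move=> [u [v [c [Su Sv ru rv ->]]]]; exists v, u, (fun k => - c k); split=> //.
  rewrite opprD opprB; congr (_ + _); rewrite -sumrN; apply: eq_bigr => k _.
  by rewrite scaleNr.
have Lray u : S u -> on_ray i u -> L (mrow u).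
  move=> Su ru; exists u, 0%MM, (fun=> 0); split; rewrite ?on_ray0 //.
  rewrite big1 => [|k _]; last by rewrite scale0r.
  by rewrite addr0; apply/rowP => k; rewrite !mxE mnm0E subr0.
have Lh k : k != i -> L (mrow (h k)).
  move=> ki; exists 0%MM, 0%MM, (fun l => (l == k)%:R); split; rewrite ?on_ray0 //.
  rewrite subrr add0r (bigD1 k) //= eqxx scale1r big1 ?addr0 // => l /andP [_ /negPf ->].
  by rewrite scale0r.
have Lnear m m' : near n i m m' -> L (mrow m') <-> L (mrow m).
  move=> [u [v [Su Sv ru rv /(congr1 (@mrow s))]]]; rewrite !mrowD => E.
  split=> Lm.
    have -> : mrow m = mrow m' + mrow v - mrow u by rewrite -E addrK.
    by apply/LD/LN/Lray => //; apply/LD/Lray.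
  have -> : mrow m' = mrow m + mrow u - mrow v by rewrite E addrK.
  by apply/LD/LN/Lray => //; apply/LD/Lray.
(* The degree off the ray is constant on classes and positive off the ray, hence suited to induction
   on decompositions up to [near]. *)
pose off_deg m := (\sum_(l | l != i) m l)%N.
have off_degD u v : off_deg (u + v)%MM = (off_deg u + off_deg v)%N.
  by rewrite -big_split; apply: eq_bigr => l _; rewrite mnmDE.
have off_deg_gt0 m : ~~ on_ray i m -> (0 < off_deg m)%N.
  by move=> /offP [l li ml]; rewrite /off_deg (bigD1 l) //=; lia.
have LS m : S m -> L (mrow m).
  have [d] := ubnP (off_deg m); elim: d m => // d IH m ltd Sm; apply: contrapT => nL.
  have irrm : ray_irreducible n i m.
    split=> // [|u v Su Sv nu nv nr]; first by apply/negP => /(Lray _ Sm).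
    have E : off_deg (u + v)%MM = off_deg m by apply: eq_bigr => l li; apply: near_coord nr li.
    apply/nL/(Lnear _ _ nr); rewrite mrowD.
    by apply: LD; apply: IH => //; have := off_deg_gt0 _ nu; have := off_deg_gt0 _ nv;
      rewrite off_degD in E; lia.
  have [k ki [nr|nr]] := nonsingular_irreducibles t0 (multiples i) ns hirr irrm hsep.
    by apply/nL/(Lnear _ _ nr)/Lh.
  by apply/nL/(Lnear _ _ nr)/Lh.
have LT x : L x by have [u [v [Su Sv ->]]] := Sgroup x; apply/LD/LN; apply: LS.
have coord (x : 'rV[int]_s) : exists (u v : 'X_{1..s}) (cf : 'I_s -> int),
    [/\ S u, S v, on_ray i u, on_ray i v &
    (forall k, k != i -> x 0 k = cf k * (h k k)%:Z) /\
    ((forall k, k != i -> cf k = 0) -> x 0 i = (u i)%:Z - (v i)%:Z)].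
  have [u [v [cf [Su Sv ru rv ->]]]] := LT x; exists u, v, cf; split=> //; split=> [k ki|cf0].
    rewrite !mxE summxE (on_rayP _ _ ru) // (on_rayP _ _ rv) // subrr add0r.
    rewrite (bigD1 k) //= !mxE big1 ?addr0 // => l /andP [li lk].
    have [_ _ hl _] := hP l li.
    by rewrite !mxE hl ?mulr0 // eq_sym.
  by rewrite !mxE summxE big1 ?addr0 // => l li; rewrite !mxE cf0 // mul0r.
split=> [k ki|].
  have [u [v [cf [_ _ _ _ [/(_ k ki) + _]]]]] := coord (mrow U_(k)%MM).
  rewrite mxE mnm1E eqxx => E; have hk1 : h k k = 1%N.
    by have /esym/eqP := congr1 absz E; rewrite abszM muln_eq1 => /andP [_ /eqP].
  have [Sh _ hl _] := hP k ki; exists (h k i).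
  have -> : (U_(i) *+ h k i + U_(k))%MM = h k => //.
  apply/mnmP => l; rewrite mnmDE mulmnE !mnm1E.
  have [->|li] := eqVneq l i; first by rewrite ?eqxx (negPf ki) mul1n addn0.
  have [->|lk] := eqVneq l k; first by rewrite ?eqxx hk1.
  by rewrite (hl l).
have [u [v [cf [Su Sv ru rv [ck ci]]]]] := coord (mrow U_(i)%MM).
exists u, v; split=> //.
have /ci : forall k, k != i -> cf k = 0.
  move=> k ki; have := ck k ki; have [_ hk _ _] := hP k ki.
  by rewrite mxE mnm1E eq_sym (negPf ki); nia.
by rewrite mxE mnm1E eqxx; lia.
Qed.

End Ray.

(** For 0 < t0 < e and t0 <= 1 the axis point lies in the neighbourhood of isolatedness: its nonzero
    coordinates are t0^d with d > 0, as no generator is 0. It differs from 0 because a multiple of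
    U_i in S requires a generator on the ray. *)
Lemma isolated_ray_structure : isolated_singularity_at_origin R g -> forall i,
  (forall k, k != i -> exists a, S (U_(i) *+ a + U_(k))%MM) /\
  (exists u v, [/\ S u, S v, on_ray i u, on_ray i v & u i = (v i).+1]).
Proof.
move=> [X0 _ [e e0 ns]] i.
have n0 := variety_origin_neq0 X0.
pose t0 : R := Num.min e 1 / 2.
have [t00 t0e t01] : [/\ 0 < t0, t0 < e & t0 <= 1].
  by rewrite /t0; case: (lerP e 1) => ?; split; lra.
have t00C : (0 : C) < t0%:C%C by rewrite ltcR.
have tn0 : (t0%:C)%C != 0 :> C by rewrite gt_eqF.
apply: (ray_structure tn0); apply: ns.
- exact: variety_char (ray_char0 _ _) (@ray_charD _ _ _ _ _ _).
- have [q q0 [b bE]] := multiples i.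
  have b0 : b != 0%MM.
    apply/eqP => b0; have := congr1 (fun x : 'X_{1..s} => x i) bE.
    by rewrite b0 msum0 mulmnE mnm1E eqxx mnm0E; lia.
  have [j [c [bj0 _]]] := mnm_neq0_split b0.
  have rj : on_ray i (n j).
    apply/on_rayP => k ki; have := congr1 (fun x : 'X_{1..s} => x k) bE.
    rewrite mulmnE mnm1E eq_sym (negPf ki) mul0n mnm_sumE (bigD1 j) //= mulmnE.
    by move/esym/eqP; rewrite addn_eq0 muln_eq0 (negPf bj0) orbF => /andP [/eqP].
  apply/eqP => /rowP /(_ j); rewrite !mxE /ray_char rj => /eqP.
  by rewrite expf_eq0 (negPf tn0) andbF.
move=> j; rewrite mxE /ray_char; case: ifP => [rj|_]; last by rewrite normr0 ltcR.
have : n j i != 0%N.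
  apply: contra (n0 j) => /eqP nji; apply/eqP/mnmP => k; rewrite mnm0E.
  by have [->//|ki] := eqVneq k i; apply: (on_rayP _ _ rj).
case: (n j i) => // d _; rewrite ger0_norm ?exprn_ge0 ?ltW // exprS.
apply: (@le_lt_trans _ _ (t0%:C)%C); last by rewrite ltcR.
apply: ler_piMr; first exact: ltW.
by apply: exprn_ile1; [exact: ltW|rewrite lecR].
Qed.

End LocalStructure.

(** * Counting generators *)

Section Counting.
Context (s p : nat) (n : 'I_p -> 'X_{1..s}).
Local Notation S := (in_semigroup n).
Implicit Types (m u v : 'X_{1..s}).
Hypothesis n_neq0 : forall j, n j != 0%MM.

Lemma in_semigroup_split m : S m -> m != 0%MM ->
  exists j m', [/\ S m', m = (n j + m')%MM & (mdeg m' < mdeg m)%N].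
Proof.
move=> [b ->] b0; have /mnm_neq0_split [j [c [_ ->]]] : b != 0%MM.
  by apply: contraNneq b0 => ->; rewrite msum0.
exists j, (msum n c); rewrite msumD msumU mdegD; split; [by exists c|by []|].
by have := n_neq0 j; rewrite -mdeg_eq0; lia.
Qed.

Lemma in_semigroup_ray_ind i (Q : 'X_{1..s} -> Prop) : Q 0%MM ->
  (forall u v, Q u -> Q v -> Q (u + v)%MM) -> (forall j, on_ray i (n j) -> Q (n j)) ->
  forall m, S m -> on_ray i m -> Q m.
Proof.
move=> Q0 QD Qn m; have [d] := ubnP (mdeg m); elim: d m => // d IH m ltd Sm rm.
have [->//|m0] := eqVneq m 0%MM.
have [j [m' [Sm' E ltm]]] := in_semigroup_split Sm m0.
by move: rm; rewrite E on_rayD => /andP [rj rm']; apply: QD; [exact: Qn|apply: IH => //; lia].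
Qed.

Lemma in_semigroup_unit k : S U_(k)%MM -> exists j, n j = U_(k)%MM.
Proof.
move=> /in_semigroup_split []; first by rewrite mnm1_eq0.
move=> j [m' [_ E _]]; exists j.
have := congr1 (@mdeg s) E; rewrite mdegD mdeg1 => Ed.
have /eqP : mdeg m' = 0%N by have := n_neq0 j; rewrite -mdeg_eq0; lia.
by rewrite mdeg_eq0 => /eqP m'0; rewrite E m'0 addm0.
Qed.

Lemma on_rayE i m : on_ray i m -> m = (U_(i) *+ m i)%MM.
Proof.
move=> /on_rayP rm; apply/mnmP => k; rewrite mulmnE mnm1E.
by have [->|ki] := eqVneq i k; rewrite ?mul1n // mul0n rm // eq_sym.
Qed.

Lemma on_ray_uniq i k m : m != 0%MM -> on_ray i m -> on_ray k m -> i = k.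
Proof.
move=> m0 /on_rayP ri /on_rayP rk; apply/eqP; apply: contraT => ik.
case/eqP: m0; apply/mnmP => l; rewrite mnm0E.
by have [->|li] := eqVneq l i; [apply: rk|apply: ri].
Qed.

Lemma ray_generator i : (exists u v, [/\ S u, S v, on_ray i u, on_ray i v & u i = (v i).+1]) ->
  exists j, on_ray i (n j).
Proof.
move=> [u [v [Su _ ru _ E]]]; apply: contrapT => nex.
have u0 : u = 0%MM.
  move: u Su ru {E}; apply: in_semigroup_ray_ind => // [? ? -> ->|j rj]; first by rewrite addm0.
  by case: nex; exists j.
by move: E; rewrite u0 mnm0E.
Qed.

(** A common divisor of the generators on the ray divides two consecutive integers. *)
Lemma ray_gcd i d : (exists u v, [/\ S u, S v, on_ray i u, on_ray i v & u i = (v i).+1]) ->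
  (forall j, on_ray i (n j) -> (d %| n j i)%N) -> d = 1%N.
Proof.
move=> [u [v [Su Sv ru rv E]]] dn.
have dvd m : S m -> on_ray i m -> (d %| m i)%N.
  move: m; apply: in_semigroup_ray_ind => // [|x y dx dy]; first by rewrite mnm0E.
  by rewrite mnmDE dvdn_add.
have := dvd u Su ru; rewrite E -addn1 dvdn_addr ?dvd // dvdn1.
by move/eqP.
Qed.

(** If all generators on the ray coincided, their coordinate would be 1 by [ray_gcd], and U_i would
    lie in S. *)
Lemma two_ray_generators i :
  (exists u v, [/\ S u, S v, on_ray i u, on_ray i v & u i = (v i).+1]) ->
  ~ S U_(i)%MM -> exists j l, [/\ on_ray i (n j), on_ray i (n l) & (n j i < n l i)%N].
Proof.
move=> ray nS; have [j rj] := ray_generator ray; apply: contrapT => nex.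
have nlt a b : on_ray i (n a) -> on_ray i (n b) -> (n b i <= n a i)%N.
  by move=> ra rb; rewrite leqNgt; apply/negP => lt; apply: nex; exists a, b.
have d1 : n j i = 1%N.
  apply: (ray_gcd ray) => l rl; suff -> : n l i = n j i by [].
  by apply/eqP; rewrite eqn_leq !nlt.
apply: nS; have -> : U_(i)%MM = n j by rewrite (on_rayE rj) d1 mulm1n.
exact: in_semigroup_gen.
Qed.

(** Split off a generator. If it has i-th coordinate 1, it is the required one, its slant being
    positive because U_i is missing from S; otherwise it lies on the k-th axis, and removing it
    lowers [a]. *)
Lemma slanted_generator i k a : i != k -> ~ S U_(i)%MM -> S (U_(k) *+ a + U_(i))%MM ->
  exists j l, (0 < l)%N /\ n j = (U_(k) *+ l + U_(i))%MM.
Proof.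
move=> ik nS; elim/ltn_ind: a => a IH Sa.
have neq0 : (U_(k) *+ a + U_(i))%MM != 0%MM.
  by apply/eqP => /mnmP /(_ i); rewrite mnmDE mnm1E eqxx mnm0E addn1.
have [j [m' [Sm' E _]]] := in_semigroup_split Sa neq0.
have co l : ((k == l) * a + (i == l) = n j l + m' l)%N.
  by rewrite -mnmDE -E mnmDE mulmnE !mnm1E.
have off l : l != k -> l != i -> n j l = 0%N /\ m' l = 0%N.
  by move=> lk li; have := co l; rewrite eq_sym (negPf lk) eq_sym (negPf li); lia.
have := co i; rewrite eqxx eq_sym (negPf ik) => ci.
have := co k; rewrite eqxx (negPf ik) => ck.
have nE m (c : nat) : (forall l, l != k -> l != i -> m l = 0%N) -> m i = c ->
    m = (U_(k) *+ m k + U_(i) *+ c)%MM.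
  move=> moff mi; apply/mnmP => l; rewrite mnmDE !mulmnE !mnm1E.
  have [<-|lk] := eqVneq k l; first by rewrite (negPf ik) mul1n addn0.
  have [<-|li] := eqVneq i l; first by rewrite mul1n.
  by rewrite moff // eq_sym.
have [nji|nji] : n j i = 1%N \/ n j i = 0%N by lia.
  exists j, (n j k); split; last by rewrite {1}(nE (n j) 1%N) ?mulm1n // => l ? ?; case: (off l).
  rewrite lt0n; apply/eqP => njk; apply: nS; exists U_(j)%MM.
  by rewrite msumU (nE (n j) 1%N) // ?njk ?mulm0n ?add0m ?mulm1n // => l ? ?; case: (off l).
have njE := nE (n j) 0%N (fun l lk li => (off l lk li).1) nji.
apply: (IH (m' k)).
  have : n j k != 0%N.
    by apply: contra (n_neq0 j) => /eqP njk; rewrite njE njk !mulm0n addm0.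
  by lia.
by rewrite -[U_(i)%MM]mulm1n -nE // => [l ? ?|]; [case: (off l)|lia].
Qed.

End Counting.

Section NormalForm.
Context (s : nat) (n : 'I_(2 * s) -> 'X_{1..s}).
Local Notation S := (in_semigroup n).
Hypothesis n_neq0 : forall j, n j != 0%MM.
Hypothesis rays : forall i,
  (forall k, k != i -> exists a, S (U_(i) *+ a + U_(k))%MM) /\
  (exists u v, [/\ S u, S v, on_ray i u, on_ray i v & u i = (v i).+1]).

(* If U_i is not in S, one generator per ray, a second one on the i-th ray and the s - 1
   slanted ones are already 2s distinct generators. *)
Lemma normal_form_of_rays i : ~ S U_(i)%MM ->
  exists (lam : 'I_s -> nat) (N M : nat), [/\ forall k, k != i -> (0 < lam k)%N,
    (1 < N < M)%N, gcdn N M = 1%N &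
    forall x, (exists j, x = n j) <->
      [\/ exists2 k, k != i & x = U_(k)%MM,
          exists2 k, k != i & x = (U_(k) *+ lam k + U_(i))%MM,
          x = (U_(i) *+ N)%MM | x = (U_(i) *+ M)%MM]].
Proof.
move=> nSi.
have [j1 [j2 [r1 r2 lt12]]] := two_ray_generators n_neq0 (rays i).2 nSi.
have /choice [A rA] : forall k, exists j, on_ray k (n j).
  by move=> k; apply: ray_generator => //; apply: (rays k).2.
have : forall k, exists bl : 'I_(2 * s) * nat, k != i ->
    (0 < bl.2)%N /\ n bl.1 = (U_(k) *+ bl.2 + U_(i))%MM.
  move=> k; have [->|ki] := eqVneq k i; first by exists (j1, 0%N).
  have ik : i != k by rewrite eq_sym.
  have [a Sa] := (rays k).1 i ik.
  have [j [l [l0 E]]] := slanted_generator n_neq0 ik nSi Sa.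
  by exists (j, l).
move=> /choice [B BE]; pose lam k := (B k).2.
(* Left slots hold one generator per axis, right slots the slanted ones, with the second generator
   of the i-th axis at [i]. Injectivity on these 2s slots makes [io] onto. *)
pose io (x : 'I_s + 'I_s) := match x with
  | inl k => if k == i then j1 else A k
  | inr k => if k == i then j2 else (B k).1 end.
have rl k : on_ray k (n (io (inl k))).
  by rewrite /io; case: (eqVneq k i) => [->|_].
have rr k : k != i -> (0 < n (io (inr k)) k)%N /\ n (io (inr k)) i = 1%N.
  move=> ki; rewrite /io (negPf ki); have [l0 ->] := BE k ki.
  by rewrite !mnmDE !mulmnE !mnm1E !eqxx (negPf ki) eq_sym (negPf ki); lia.
have rr_off k l : k != i -> l != i -> (0 < n (io (inr k)) l)%N -> l = k.
  move=> ki li; rewrite /io (negPf ki); have [l0 ->] := BE k ki.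
  rewrite mnmDE mulmnE !mnm1E [i == l]eq_sym (negPf li).
  by case: eqVneq => // _; rewrite mul0n.
have rri : io (inr i) = j2 by rewrite /io eqxx.
have rli : io (inl i) = j1 by rewrite /io eqxx.
have rray k l : on_ray l (n (io (inr k))) -> k = i /\ l = i.
  have [->|ki] := eqVneq k i.
    by rewrite rri => rl2; split=> //; apply: on_ray_uniq r2.
  have [nk ni] := rr k ki; move=> /on_rayP r; exfalso.
  have [El|/r] := eqVneq i l; last by rewrite ni.
  by move: nk; rewrite r // -El.
have io_inj : injective io.
  move=> [k|k] [l|l] E.
  - by have := rl k; rewrite E => /(on_ray_uniq (n_neq0 _) (rl l)) ->.
  - have := rl k; rewrite E => /rray [E1 E2]; move: E; rewrite E1 E2 rli rri => E.
    by rewrite E ltnn in lt12.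
  - have := rl l; rewrite -E => /rray [E1 E2]; move: E; rewrite E1 E2 rli rri => E.
    by rewrite E ltnn in lt12.
  have [ki|ki] := eqVneq k i.
    have : on_ray i (n (io (inr l))) by rewrite -E ki rri.
    by move=> /rray [-> _]; rewrite ki.
  have [li|li] := eqVneq l i.
    have : on_ray i (n (io (inr k))) by rewrite E li rri.
    by move=> /rray [-> _]; rewrite li.
  by have [nk _] := rr k ki; rewrite E in nk; rewrite (rr_off l k).
have io_surj j : exists x, j = io x.
  have : j \in codom io.
    by apply: inj_card_onto => //; rewrite card_sum !card_ord mul2n addnn.
  by move=> /codomP [x ->]; exists x.
have ray_gen k j : k != i -> on_ray k (n j) -> j = io (inl k).
  move=> ki; have [[l|l] ->] := io_surj j.
    by move=> /(on_ray_uniq (n_neq0 _) (rl l)) ->.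
  by move=> /rray [_ kE]; rewrite kE eqxx in ki.
have unit_gen k : k != i -> n (io (inl k)) = U_(k)%MM.
  move=> ki; have [Sk|nSk] := pselect (S U_(k)%MM).
    have [j nj] := in_semigroup_unit n_neq0 Sk.
    rewrite -(ray_gen k j ki) // nj; apply/on_rayP => l lk.
    by rewrite mnm1E eq_sym (negPf lk).
  (* Without U_k in S there would be two generators on the k-th axis, but only one slot holds such a
     generator. *)
  have [a [b [ra rb lt]]] := two_ray_generators n_neq0 (rays k).2 nSk.
  by move: lt; rewrite (ray_gen k a) // (ray_gen k b) // ltnn.
have n1E := on_rayE r1; have n2E := on_rayE r2.
exists lam, (n j1 i), (n j2 i); split.
- by move=> k /BE [].
- rewrite lt12 andbT ltnNge; apply/negP => le1.
  have : n j1 i != 0%N by apply: contra (n_neq0 j1) => /eqP E; rewrite n1E E mulm0n.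
  have [E|] : n j1 i = 1%N \/ n j1 i = 0%N by lia.
    by move=> _; apply: nSi; exists U_(j1)%MM; rewrite msumU n1E E mulm1n.
  by move=> ->.
- apply: (ray_gcd n_neq0 (rays i).2) => j; have [[k|k] ->] := io_surj j => rj.
    have <- := on_ray_uniq (n_neq0 _) rj (rl k).
    by rewrite rli dvdn_gcdl.
  by have [-> _] := rray _ _ rj; rewrite rri dvdn_gcdr.
move=> x; split=> [[j ->]|].
  have [[k|k] ->] := io_surj j.
    have [->|ki] := eqVneq k i; first by rewrite rli; apply: Or43.
    by apply: Or41; exists k => //; apply: unit_gen.
  have [->|ki] := eqVneq k i; first by rewrite rri; apply: Or44.
  by apply: Or42; exists k => //; rewrite /io (negPf ki); have [_ ->] := BE k ki.
case=> [[k ki ->]|[k ki ->]|->|->].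
- by exists (io (inl k)); rewrite unit_gen.
- by exists (B k).1; have [_ ->] := BE k ki.
- by exists j1.
- by exists j2.
Qed.

End NormalForm.

(** * Normal forms *)

Lemma mulrn_mulmx (A : nzRingType) m n p (x : 'M[A]_(m, n)) (M : 'M[A]_(n, p)) k :
  (x *+ k) *m M = (x *m M) *+ k.
Proof. exact: (raddfMn (mulmxr M)). Qed.

Section Transfer.
Context (R : realType) (s p : nat) (g : 'I_p -> 'rV[int]_s).

Lemma gsum_mul (M : 'M[int]_s) b : gsum (fun j => g j *m M) b = gsum g b *m M.
Proof. by rewrite /gsum mulmx_suml; apply: eq_bigr => j _; rewrite mulrn_mulmx. Qed.

(** I_S depends only on the integral relations among the generators, and an invertible change of
    coordinates preserves these. *)
Lemma toric_ideal_unitmx (M : 'M[int]_s) : M \in unitmx ->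
  toric_ideal (R := R) (fun j => g j *m M) = toric_ideal g.
Proof.
move=> Mu; rewrite /toric_ideal /toric_binomials.
suff -> : [set a : 'rV[int]_p | \sum_(i < p) a 0 i *: (g i *m M) = 0] =
    [set a : 'rV[int]_p | \sum_(i < p) a 0 i *: g i = 0] by [].
have E (a : 'rV[int]_p) : \sum_(i < p) a 0 i *: (g i *m M) =
    (\sum_(i < p) a 0 i *: g i) *m M.
  by rewrite mulmx_suml; apply: eq_bigr => j _; rewrite scalemxAl.
apply/seteqP; split=> a /=; rewrite E; last by move=> ->; rewrite mul0mx.
by move=> aM; rewrite -[LHS](mulmxK Mu) aM mul0mx.
Qed.

Lemma isolated_singularity_unitmx (M : 'M[int]_s) : M \in unitmx ->
  isolated_singularity_at_origin R (fun j => g j *m M) =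
  isolated_singularity_at_origin R g.
Proof.
move=> Mu; rewrite /isolated_singularity_at_origin /nonsingular_at /tangent_space
  /toric_variety.
by rewrite toric_ideal_unitmx.
Qed.

End Transfer.

Section Isomorphisms.
Context (s : nat).
Implicit Types (G : set 'rV[int]_s).

Lemma generated_image (M : 'M[int]_s) G : semigroup_generated_by [set x *m M | x in G] =
  [set x *m M | x in semigroup_generated_by G].
Proof.
apply/seteqP; split=> z.
  move: z; apply: generated_min => [|_ _ [x Gx <-] [y Gy <-]|_ [x Gx <-]].
  - by exists 0; [exact: generated0|rewrite mul0mx].
  - by exists (x + y); [exact: generatedD|rewrite mulmxDl].
  - by exists x => //; apply: generated_mem.
move=> [x Gx <-]; move: x Gx.
apply: (@generated_min _ G (fun x => semigroup_generated_by [set x *m M | x in G] (x *m M))).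
- by rewrite mul0mx; apply: generated0.
- by move=> x y; rewrite mulmxDl; apply: generatedD.
- by move=> x Gx; apply: generated_mem; exists x.
Qed.

Lemma isomorphic_unitmx (M : 'M[int]_s) (S : set 'rV[int]_s) : M \in unitmx ->
  semigroup_isomorphic S [set x *m M | x in S].
Proof.
move=> Mu; exists (fun x => x *m M); split; last by move=> x y _ _; rewrite mulmxDl.
split=> [x Sx|x y _ _ E|y [x Sx <-]]; [by exists x| |by exists x].
by rewrite -[x](mulmxK Mu) E mulmxK.
Qed.

(** The distinguished axis is an arbitrary [i], because geometry decides which U_i is missing from
    S; a transposition moves it to the last place later. *)
Definition normal_form i (lam : 'I_s -> nat) (N M : nat) : set 'X_{1..s} :=
  [set x | [\/ exists2 k, k != i & x = U_(k)%MM,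
          exists2 k, k != i & x = (U_(k) *+ lam k + U_(i))%MM,
          x = (U_(i) *+ N)%MM | x = (U_(i) *+ M)%MM]].

Lemma mrow_perm (pi : 'S_s) x : mrow x *m perm_mx pi^-1%g = mrow [multinom x (pi k) | k < s].
Proof.
rewrite -col_permE; apply/rowP => k; rewrite !mxE mnmE.
by rewrite ?invgK.
Qed.

End Isomorphisms.

Lemma e_ord s (k : 'I_s) : e_ s k.+1 = mrow U_(k)%MM.
Proof.
apply/rowP => j; rewrite !mxE mnm1E eqSS eq_sym.
by case: eqP => [/ord_inj ->|]; case: eqP => // ->.
Qed.

Lemma normal_form_generatorsE s (lam : nat -> nat) N M :
  normal_form_generators s.+1 lam N M =
  [set mrow x | x in normal_form (ord_max : 'I_s.+1) (fun k => lam k.+1) N M].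
Proof.
have em : e_ s.+1 s.+1 = mrow U_(ord_max : 'I_s.+1)%MM by rewrite -e_ord.
have ltmax (k : 'I_s.+1) : k != ord_max -> (k < s)%N.
  by move=> km; rewrite ltn_neqAle -ltnS ltn_ord andbT; apply: contraNneq km => E;
    apply/eqP/val_inj.
have ordk k : (1 <= k < s.+1)%N -> exists2 j : 'I_s.+1, j != ord_max & k = j.+1.
  case: k => // k /andP [_ ltk]; exists (Ordinal (ltnW ltk : k < s.+1)%N) => //.
  by apply/eqP => /(congr1 val) /=; move: ltk => /[swap] ->; rewrite ltnn.
rewrite /normal_form_generators; apply/seteqP; split=> x.
  case=> [[[k /= /ordk [j jm ->] <-]|[k /= /ordk [j jm ->] <-]]|[->|->]].
  - by exists U_(j)%MM; [apply: Or41; exists j|rewrite e_ord].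
  - exists (U_(j) *+ lam j.+1 + U_(ord_max))%MM; first by apply: Or42; exists j.
    by rewrite mrowD mrowMn e_ord em.
  - by exists (U_(ord_max) *+ N)%MM; [apply: Or43|rewrite mrowMn em].
  - by exists (U_(ord_max) *+ M)%MM; [apply: Or44|rewrite mrowMn em].
move=> [y [[k km ->]|[k km ->]|->|->] <-].
- by left; left; exists k.+1 => /=; [rewrite ltnS ltmax|rewrite e_ord].
- left; right; exists k.+1 => /=; first by rewrite ltnS ltmax.
  by rewrite mrowD mrowMn e_ord em.
- by right; left; rewrite mrowMn em.
- by right; right; rewrite mrowMn em.
Qed.

(** * From geometry to the normal form *)

Section Necessity.
Context (R : realType) (s : nat) (S : set 'rV[int]_s.+1).
Context (g : 'I_(2 * s.+1) -> 'rV[int]_s.+1).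
Hypothesis SE : S = semigroup_generated_by (range g).
Hypothesis SG : group_generated_by S = setT.
Local Notation C := R[i].

Lemma normalization_basis (f : 'I_(2 * s.+1) -> {mpoly C[s.+1]}) :
  normalization_map S g f -> exists2 B : 'M[int]_s.+1, B \in unitmx &
    forall m, saturation S m <-> forall k, 0 <= (m *m invmx B) 0 k.
Proof.
move=> [phi [phiC phi_bij _]].
have S0 : S 0 by rewrite SE; apply: generated0.
have SD : add_closed S by rewrite SE; apply: generatedD.
have NA : normalized_algebra S = semigroup_algebra (saturation S) :> set {fraction {mpoly C[s.+1]}}.
  by rewrite {1 2}SE; apply: normalized_saturation; rewrite -SE.
rewrite NA in phi_bij.
apply: (irreducible_basis _ _ phiC phi_bij).
- by exists 1%N.
- exact: saturationD.
- move=> m; have [u [v [Su Sv E]]] := group_generated_diff m S0 SD SG.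
  by exists u, v; split=> //; apply: saturation_sub.
Qed.

Lemma normal_form_of_isolated (f : 'I_(2 * s.+1) -> {mpoly C[s.+1]}) :
  isolated_singularity_at_origin R g -> normalization_map S g f ->
  exists (lambda : nat -> nat) (N M : nat),
    [/\ forall k, (1 <= k < s.+1)%N -> (0 < lambda k)%N, (1 < N < M)%N, gcdn N M = 1%N &
      semigroup_isomorphic S
        (semigroup_generated_by (normal_form_generators s.+1 lambda N M))].
Proof.
move=> iso /normalization_basis [B Bu SB].
have iBu : invmx B \in unitmx by rewrite unitmx_inv.
have gS j : S (g j) by rewrite SE; apply: generated_mem; exists j.
pose n j := [multinom absz ((g j *m invmx B) 0%R k) | k < s.+1].
have nE j : mrow (n j) = g j *m invmx B.
  by apply: mrowK; apply/SB/saturation_sub/gS.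
have gE : (fun j => mrow (n j)) = (fun j => g j *m invmx B).
  by apply/funext => j; rewrite nE.
have msumE b : mrow (msum n b) = gsum g b *m invmx B.
  by rewrite -gsum_mrow gE gsum_mul.
rewrite -(isolated_singularity_unitmx R g iBu) -gE in iso.
have inS m : S (mrow m *m B) -> in_semigroup n m.
  rewrite SE => /generatedP [b bE]; exists b; apply: mrow_inj.
  by rewrite msumE -bE mulmxK.
have multiples k : exists2 q, (0 < q)%N & in_semigroup n (U_(k) *+ q)%MM.
  have /SB [q q0 Sq] : forall l, 0 <= (mrow U_(k)%MM *m B *m invmx B) 0 l.
    by move=> l; rewrite mulmxK // mxE.
  by exists q => //; apply: inS; rewrite mrowMn mulrn_mulmx.
have Sgroup x : exists u v, [/\ in_semigroup n u, in_semigroup n v & x = mrow u - mrow v].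
  have S0 : S 0 by rewrite SE; apply: generated0.
  have SD : add_closed S by rewrite SE; apply: generatedD.
  have [u [v []]] := group_generated_diff (x *m B) S0 SD SG.
  rewrite SE => /generatedP [b ->] /generatedP [c ->] E.
  exists (msum n b), (msum n c); split; [by exists b|by exists c|].
  by rewrite !msumE -mulmxBl -E mulmxK.
have n0 : forall j, n j != 0%MM by case: iso => /variety_origin_neq0.
have rays := isolated_ray_structure multiples Sgroup iso.
have [i nSi] : exists i, ~ in_semigroup n U_(i)%MM.
  (* If S contained every U_k, the chart with r = 0 would make X(S) smooth at the origin. *)
  apply: contrapT => nex; case: iso => X0 ns0 _; apply: ns0.
  have /choice [cb cbE] : forall k, exists b, U_(k)%MM = msum n b.
    by move=> k; apply: contrapT => nSk; apply: nex; exists k.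
  apply: (@smooth_point _ _ _ _ _ 0%MM (fun=> 0%N) cb) => //.
    by rewrite mpolyX0 meval1 oner_neq0.
  by move=> k; rewrite -cbE mulm0n addm0.
have [lam [N [M [lam0 NM cop rangeE]]]] := normal_form_of_rays n0 rays nSi.
pose pi : 'S_s.+1 := tperm i ord_max.
(* [lambda] is indexed from 1, hence [k.-1]; the transposition [pi] carries the distinguished axis
   [i] to the last one. *)
exists (fun k => lam (pi (inord k.-1))), N, M; split=> //.
  move=> k /andP [k0 ks]; apply: lam0; rewrite -(tpermR i ord_max) (inj_eq perm_inj).
  by apply/eqP => /(congr1 val); rewrite /= inordK; lia.
pose Q := invmx B *m perm_mx pi^-1%g.
have Qu : Q \in unitmx by rewrite unitmx_mul iBu unitmx_perm.
suff -> : semigroup_generated_by (normal_form_generators s.+1 (fun k => lam (pi (inord k.-1))) N M) =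
  [set x *m Q | x in S] by apply: isomorphic_unitmx.
rewrite SE -generated_image normal_form_generatorsE; congr semigroup_generated_by.
have QE j : g j *m Q = mrow [multinom n j (pi k) | k < s.+1].
  by rewrite /Q mulmxA -nE mrow_perm.
have Upi k : [multinom U_(k)%MM (pi l) | l < s.+1] = U_(pi k)%MM.
  apply/mnmP => l; rewrite mnmE !mnm1E; congr (nat_of_bool _).
  by rewrite -(inj_eq (@perm_inj _ pi)) tpermK.
have piD (x y : 'X_{1..s.+1}) : [multinom (x + y)%MM (pi l) | l < s.+1] =
    ([multinom x (pi l) | l < s.+1] + [multinom y (pi l) | l < s.+1])%MM.
  by apply/mnmP => l; rewrite mnmDE !mnmE.
have piMn (x : 'X_{1..s.+1}) k : [multinom (x *+ k)%MM (pi l) | l < s.+1] =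
    ([multinom x (pi l) | l < s.+1] *+ k)%MM.
  by apply/mnmP => l; rewrite mulmnE !mnmE mulmnE.
have pii : pi i = ord_max by rewrite tpermL.
have pim : pi ord_max = i by rewrite tpermR.
have pipi k : pi (pi k) = k by rewrite tpermK.
have inordP (k : 'I_s.+1) : inord (k.+1.-1) = k by rewrite inord_val.
have pineq k : k != i -> pi k != ord_max by rewrite -pii (inj_eq perm_inj).
apply/seteqP; split=> [_ [x nfx <-]|_ [_ [j _ <-] <-]].
  have [j xE] : exists j, x = [multinom n j (pi l) | l < s.+1].
    have lift z y : (exists j, y = n j) -> z = [multinom y (pi l) | l < s.+1] ->
      exists j, z = [multinom n j (pi l) | l < s.+1] by move=> [j ->] ->; exists j.
    case: nfx => [[k km ->]|[k km ->]|->|->].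
    - apply: (lift _ U_(pi k)%MM); last by rewrite Upi pipi.
      by apply/rangeE/Or41; exists (pi k); rewrite // -pim (inj_eq perm_inj).
    - apply: (lift _ (U_(pi k) *+ lam (pi k) + U_(i))%MM).
        by apply/rangeE/Or42; exists (pi k); rewrite // -pim (inj_eq perm_inj).
      by rewrite piD piMn !Upi pipi pii inordP.
    - by apply: (lift _ (U_(i) *+ N)%MM); [apply/rangeE/Or43|rewrite piMn Upi pii].
    - by apply: (lift _ (U_(i) *+ M)%MM); [apply/rangeE/Or44|rewrite piMn Upi pii].
  by exists (g j); [exists j|rewrite QE xE].
exists [multinom n j (pi l) | l < s.+1]; last by rewrite QE.
have : exists l, n j = n l by exists j.
move=> /rangeE [[k ki ->]|[k ki ->]|->|->].
- by rewrite Upi; apply: Or41; exists (pi k); rewrite // pineq.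
- rewrite piD piMn !Upi pii; apply: Or42; exists (pi k); rewrite ?pineq //.
  by rewrite inordP pipi.
- by rewrite piMn Upi pii; apply: Or43.
- by rewrite piMn Upi pii; apply: Or44.
Qed.

End Necessity.

(** * Irreducible elements of the normal form *)

Section Sufficiency.
Context (s : nat) (i : 'I_s) (lam : 'I_s -> nat) (N M : nat).
Hypothesis lam_gt0 : forall k, k != i -> (0 < lam k)%N.
Hypothesis NM : (1 < N < M)%N.
Hypothesis copNM : gcdn N M = 1%N.
Local Notation NF := (normal_form i lam N M).
Context (n : 'I_(2 * s) -> 'X_{1..s}).
Local Notation S := (in_semigroup n).
Hypothesis NFS : NF `<=` S.
Hypothesis gensT : forall j, semigroup_generated_by [set mrow x | x in NF] (mrow (n j)).
Implicit Types (m u v x : 'X_{1..s}).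

Lemma normal_form_ind (Q : 'X_{1..s} -> Prop) : Q 0%MM ->
  (forall u v, Q u -> Q v -> Q (u + v)%MM) -> NF `<=` Q -> S `<=` Q.
Proof.
move=> Q0 QD QNF m [b ->]; elim/multinom_ind: b => [|j b IH]; first by rewrite msum0.
rewrite msumD msumU; apply: (QD) => //.
suff [x Qx E] : exists2 x, Q x & mrow (n j) = mrow x by rewrite (mrow_inj E).
move: (gensT j).
apply: (@generated_min _ _ (fun y => exists2 x, Q x & y = mrow x)) => [|y z|_ [x /QNF Qx <-]].
- by exists 0%MM; rewrite ?mrow0.
- by move=> [x Qx ->] [x' Qx' ->]; exists (x + x')%MM; [apply: (QD)|rewrite mrowD].
- by exists x.
Qed.

(** As [lam k] > 0, the slanted generators leave the axis, and only the multiples by [N] and [M]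
    contribute. *)
Lemma normal_form_ray m : S m -> on_ray i m -> exists a b, m i = (a * N + b * M)%N.
Proof.
move: m; apply: normal_form_ind => [_|u v IHu IHv|m].
- by exists 0%N, 0%N; rewrite mnm0E.
- rewrite on_rayD => /andP [/IHu [a [b E]] /IHv [a' [b' E']]].
  by exists (a + a')%N, (b + b')%N; rewrite mnmDE E E'; ring.
case=> [[k ki ->]|[k ki ->]|->|->].
- by move=> /on_rayP /(_ k ki); rewrite mnm1E eqxx.
- move=> /on_rayP /(_ k ki); rewrite mnmDE mulmnE mnm1E eqxx.
  by have := lam_gt0 ki; lia.
- by exists 1%N, 0%N; rewrite mulmnE mnm1E eqxx; lia.
- by exists 0%N, 1%N; rewrite mulmnE mnm1E eqxx; lia.
Qed.

(** As [N] and [M] exceed 1, height 1 comes from exactly one slanted generator, which brings its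
    full slant. *)
Lemma normal_form_height1 m : S m -> m i = 1%N -> exists2 k, k != i & (lam k <= m k)%N.
Proof.
move: m; apply: normal_form_ind => [|u v IHu IHv|m].
- by rewrite mnm0E.
- rewrite mnmDE => E; have [/IHu|/IHv] : u i = 1%N \/ v i = 1%N by lia.
    by move=> [k ki le]; exists k; rewrite // mnmDE (leq_trans le) ?leq_addr.
  by move=> [k ki le]; exists k; rewrite // mnmDE (leq_trans le) ?leq_addl.
case=> [[k ki ->]|[k ki ->]|->|->].
- by rewrite mnm1E (negPf ki).
- by move=> _; exists k; rewrite // mnmDE mulmnE mnm1E eqxx mul1n leq_addr.
- by rewrite mulmnE mnm1E eqxx; lia.
- by rewrite mulmnE mnm1E eqxx; lia.
Qed.

Lemma on_ray_scale (k : 'I_s) (a : nat) : on_ray k (U_(k) *+ a)%MM.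
Proof. by apply/on_rayP => l lk; rewrite mulmnE mnm1E eq_sym (negPf lk). Qed.

(** U_k has degree 1. On the i-th axis nonzero elements have coordinate at least [N], and a
    splitting of M U_i would use [N] alone, against coprimality. In a slanted generator, the summand
    of height 1 already takes all of [lam k]. *)
Lemma normal_form_irreducible x u v : NF x -> S u -> S v -> x = (u + v)%MM ->
  u = 0%MM \/ v = 0%MM.
Proof.
have on_ray_eq0 m : on_ray i m -> m i = 0%N -> m = 0%MM.
  by move=> rm mi; rewrite (on_rayE rm) mi mulm0n.
have multiple_split a : (a = N \/ a = M) -> S u -> S v -> (U_(i) *+ a)%MM = (u + v)%MM ->
    u = 0%MM \/ v = 0%MM.
  move=> aNM Su Sv E; have := on_ray_scale i a; rewrite E on_rayD => /andP [ru rv].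
  have := congr1 (fun m : 'X_{1..s} => m i) E; rewrite mulmnE mnm1E eqxx mul1n mnmDE.
  have [c [d ui]] := normal_form_ray Su ru; have [c' [d' vi]] := normal_form_ray Sv rv.
  have [u0|u0] := eqVneq (u i) 0%N; first by left; apply: on_ray_eq0.
  have [v0|v0] := eqVneq (v i) 0%N; first by right; apply: on_ray_eq0.
  have geN e f : (e * N + f * M != 0 -> N <= e * N + f * M)%N.
    by case: e => [|e]; case: f => [|f]; rewrite ?mul0n ?mulSn; lia.
  have [aN|aM] := aNM.
    move=> E2; have := geN c d; have := geN c' d'; rewrite -ui -vi u0 v0.
    by move=> /(_ isT) leu /(_ isT) lev; lia.
  rewrite aM => EM; exfalso.
  have coef0 (e r q : nat) : (e * M + r + q = M)%N -> q <> 0%N -> e = 0%N.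
    by case: e => // e; rewrite mulSn; lia.
  have d0 : d = 0%N by apply: (coef0 d (c * N) (v i))%N; [lia|apply/eqP].
  have d'0 : d' = 0%N by apply: (coef0 d' (c' * N) (u i))%N; [lia|apply/eqP].
  have : (N %| M)%N by rewrite EM ui vi d0 d'0 !mul0n !addn0 -mulnDl dvdn_mull.
  by move=> /gcdn_idPl; rewrite copNM; lia.
move=> nfx Su Sv; case: nfx => [[k ki ->]|[k ki ->]|->|->]; last 2 first.
- by apply: multiple_split => //; left.
- by apply: multiple_split => //; right.
- move=> /(congr1 (@mdeg s)); rewrite mdeg1 mdegD => E.
  have [/eqP|/eqP] : mdeg u = 0%N \/ mdeg v = 0%N by lia.
    by rewrite mdeg_eq0 => /eqP; left.
  by rewrite mdeg_eq0 => /eqP; right.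
have slanted_split u' v' : S u' -> S v' -> (U_(k) *+ lam k + U_(i))%MM = (u' + v')%MM ->
    u' i = 1%N -> v' = 0%MM.
  move=> Su' Sv' E ui; have [l li lel] := normal_form_height1 Su' ui.
  have co j : ((k == j) * lam k + (i == j) = u' j + v' j)%N.
    by rewrite -mnmDE -E mnmDE mulmnE !mnm1E.
  have lk : l = k.
    apply/eqP; apply: contraT => lk; have := co l; have := lam_gt0 li.
    by rewrite eq_sym (negPf lk) eq_sym (negPf li); lia.
  apply/mnmP => j; rewrite mnm0E; have := co j.
  have [<-|jk] := eqVneq k j; first by rewrite eq_sym (negPf ki) -lk; lia.
  by have [<-|ji] := eqVneq i j; lia.
move=> E; have := congr1 (fun m : 'X_{1..s} => m i) E.
rewrite !mnmDE mulmnE !mnm1E eqxx (negPf ki) mul0n add0n => /esym ci.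
have [ui|vi] : u i = 1%N \/ v i = 1%N by lia.
  by right; apply: slanted_split E ui.
by left; apply: slanted_split vi => //; rewrite E addmC.
Qed.

Lemma normal_form_neq0 x : NF x -> x != 0%MM.
Proof.
case=> [[k ki ->]|[k ki ->]|->|->]; apply/eqP => /mnmP.
- by move=> /(_ k); rewrite mnm1E eqxx mnm0E.
- by move=> /(_ i); rewrite mnmDE mnm1E eqxx mnm0E addn1.
- by move=> /(_ i); rewrite mulmnE mnm1E eqxx mnm0E; lia.
- by move=> /(_ i); rewrite mulmnE mnm1E eqxx mnm0E; lia.
Qed.

(** Any family generating the semigroup must contain its irreducible elements. *)
Lemma normal_form_generator x : NF x -> exists j, x = n j.
Proof.
move=> nfx; have [b xE] := NFS nfx.
have [j [bj nj]] : exists j, b j != 0%N /\ n j != 0%MM.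
  apply: contrapT => nex; have := normal_form_neq0 nfx; rewrite xE.
  suff -> : msum n b = 0%MM by rewrite eqxx.
  apply: big1 => j _; have [->|nj] := eqVneq (n j) 0%MM.
    by apply/mnmP => k; rewrite mulmnE mnm0E.
  have [->|bj] := eqVneq (b j) 0%N; first by rewrite mulm0n.
  by case: nex; exists j.
have [c bE] : exists c, b = (U_(j) + c)%MM.
  by exists (b - U_(j))%MM; rewrite addmC submK // lep1mP.
exists j; have E : x = (n j + msum n c)%MM by rewrite xE bE msumD msumU.
have [n0|c0] := normal_form_irreducible nfx (in_semigroup_gen n j) (ex_intro _ c erefl) E.
  by rewrite n0 eqxx in nj.
by rewrite E c0 addm0.
Qed.

Definition nf (z : 'I_s + 'I_s) : 'X_{1..s} := match z with
  | inl k => if k == i then (U_(i) *+ N)%MM else U_(k)%MM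
  | inr k => if k == i then (U_(i) *+ M)%MM else (U_(k) *+ lam k + U_(i))%MM end.

Lemma nfP z : NF (nf z).
Proof.
case: z => k /=; have [_|ki] := eqVneq k i; [exact: Or43| |exact: Or44|].
  by apply: Or41; exists k.
by apply: Or42; exists k.
Qed.

Lemma nf_inj : injective nf.
Proof.
have co z k : nf z k = match z with
  | inl l => if l == i then ((i == k) * N)%N else (l == k) : nat
  | inr l => if l == i then ((i == k) * M)%N else ((l == k) * lam l + (i == k))%N end.
  by case: z => l /=; case: eqVneq => _; rewrite ?mnmDE ?mulmnE !mnm1E.
move=> y z E; have Ek k := congr1 (fun m : 'X_{1..s} => m k) E.
have := Ek i; rewrite !co.
case: y E Ek => [k|k] E Ek; case: z E Ek => [l|l] E Ek;
  have [ki|ki] := eqVneq k i; have [li|li] := eqVneq l i;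
  rewrite ?eqxx ?(negPf ki) ?(negPf li) ?mul0n //; try lia.
- by rewrite ki li.
- have := Ek k; rewrite !co (negPf ki) (negPf li) eqxx.
  by case: eqVneq => [->|] //.
- by rewrite ki li.
have := Ek k; rewrite !co (negPf ki) (negPf li) eqxx [i == k]eq_sym (negPf ki).
by case: eqVneq => [->|] //; have := lam_gt0 ki; lia.
Qed.

(** The 2s distinct irreducible elements all occur among 2s generators, so they exhaust these
    without repetition. *)
Lemma normal_form_enumeration : exists io : 'I_s + 'I_s -> 'I_(2 * s),
  [/\ injective io, forall z, n (io z) = nf z & forall j, exists z, j = io z].
Proof.
have /choice [io ioE] := fun z => normal_form_generator (nfP z).
have io_inj : injective io by move=> y z E; apply: nf_inj; rewrite !ioE E.
exists io; split=> // j.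
have : j \in codom io by apply: inj_card_onto => //; rewrite card_sum !card_ord mul2n addnn.
by move=> /codomP [x ->]; exists x.
Qed.

End Sufficiency.

Section OriginTangent.
Context (F : comNzRingType) (p : nat) (v : 'rV[F]_p).
Local Notation O := (0 : 'rV[F]_p).

Lemma meval_origin b : 'X_[b].@[O 0] = (b == 0%MM)%:R.
Proof.
have [->|b0] := eqVneq b 0%MM; first by rewrite mpolyX0 meval1.
have [j [c [_ ->]]] := mnm_neq0_split b0.
by rewrite mevalXD mevalXU mxE mul0r.
Qed.

Lemma point_deriv_origin b : mdeg b != 1%N -> point_deriv O v 'X_[b] = 0.
Proof.
have [->|b0] := eqVneq b 0%MM; first by rewrite point_deriv1.
have [j [c [_ ->]]] := mnm_neq0_split b0.
rewrite mdegD mdeg1 point_derivXD !meval_origin mnm1_eq0 mul0r add0r.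
by have [->|_ _] := eqVneq c 0%MM; rewrite ?mdeg0 ?mul0r.
Qed.

End OriginTangent.

(** * Singularity of the normal form *)

Section SufficiencyGeometry.
Context (R : realType) (s : nat) (i : 'I_s) (lam : 'I_s -> nat) (N M : nat).
Hypothesis lam_gt0 : forall k, k != i -> (0 < lam k)%N.
Hypothesis NM : (1 < N < M)%N.
Hypothesis copNM : gcdn N M = 1%N.
Local Notation NF := (normal_form i lam N M).
Context (n : 'I_(2 * s) -> 'X_{1..s}).
Hypothesis NFS : NF `<=` in_semigroup n.
Hypothesis gensT : forall j, semigroup_generated_by [set mrow x | x in NF] (mrow (n j)).
Local Notation C := R[i].
Local Notation g := (fun j => mrow (n j)).

Lemma isolated_of_normal_form : isolated_singularity_at_origin R g.
Proof.
have [io [io_inj ioE io_surj]] := normal_form_enumeration lam_gt0 NM copNM NFS gensT.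
have nNF j : NF (n j) by have [z ->] := io_surj j; rewrite ioE; apply: nfP.
have n_inj : injective n.
  move=> j l; have [y ->] := io_surj j; have [z ->] := io_surj l.
  by rewrite !ioE => /(nf_inj lam_gt0 NM) ->.
have n0 j : n j != 0%MM by apply: normal_form_neq0 (nNF j).
have msum_eq0 b : msum n b = 0%MM -> b = 0%MM.
  have [//|/mnm_neq0_split [j [c [_ ->]]]] := eqVneq b 0%MM.
  by rewrite msumD msumU => /eqP; rewrite mnmD_eq0 (negPf (n0 j)).
have X0 : toric_variety g (0 : 'rV[C]_(2 * s)).
  apply/toric_varietyP => b c /gsum_mrow_eq E; rewrite !meval_origin.
  suff -> : (b == 0%MM) = (c == 0%MM) by [].
  by apply/idP/idP => /eqP b0; apply/eqP/msum_eq0; [rewrite -E|rewrite E]; rewrite b0 msum0.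
(* Generators are irreducible and distinct, so no other monomial represents the same element as a
   single variable. The binomials thus have no linear part, and every vector is tangent at 0. *)
have msum_unit b c : mdeg b = 1%N -> msum n b = msum n c -> b = c.
  move=> /eqP/mdeg1P [j /eqP ->]; rewrite msumU => E.
  have /mnm_neq0_split [l [d [_ dE]]] : c != 0%MM.
    by apply: contraNneq (n0 j) => c0; rewrite E c0 msum0.
  rewrite dE msumD msumU in E.
  have [nl|/msum_eq0 d0] := normal_form_irreducible lam_gt0 NM copNM gensT (nNF j)
      (in_semigroup_gen n l) (ex_intro _ d erefl) E.
    by case/eqP: (n0 l).
  by rewrite dE d0 addm0; move: E; rewrite d0 msum0 addm0 => /n_inj ->.
have T0 v : tangent_space g (0 : 'rV[C]_(2 * s)) v.
  apply/(tangent_spaceP _ X0) => b c /gsum_mrow_eq E.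
  have [/eqP b1|b1] := boolP (mdeg b == 1%N); first by rewrite (msum_unit b c).
  have [/eqP c1|c1] := boolP (mdeg c == 1%N); first by rewrite (msum_unit c b).
  by rewrite !point_deriv_origin.
split=> //.
  move=> ns; have : (2 * s <= s)%N.
    by apply: (has_dim_ge (A := 1%:M) _ ns) => //; rewrite row_free_unit unitmx1.
  by case: s i => [[]//|] *; lia.
(* Any radius works: X(S) is nonsingular at every nonzero point. *)
exists 1 => // P XP P0 _.
pose jl k := io (inl k); pose jr k := io (inr k).
have jlE k : k != i -> n (jl k) = U_(k)%MM by move=> ki; rewrite ioE /= (negPf ki).
have jrE k : k != i -> n (jr k) = (U_(k) *+ lam k + U_(i))%MM.
  by move=> ki; rewrite ioE /= (negPf ki).
have jliE : n (jl i) = (U_(i) *+ N)%MM by rewrite ioE /= eqxx.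
have jriE : n (jr i) = (U_(i) *+ M)%MM by rewrite ioE /= eqxx.
have XPE b c : msum n b = msum n c -> 'X_[b].@[P 0] = 'X_[c].@[P 0].
  by move=> E; apply: (toric_varietyP _ _).1 XP _ _ _; apply/gsum_mrow_eq.
have evU j (a : nat) : 'X_[U_(j) *+ a].@[P 0] = P 0 j ^+ a by rewrite mevalXMn mevalXU.
(* Where U_k is invertible, U_i is the slanted generator minus [lam k] times U_k. *)
have caseA k : k != i -> P 0 (jl k) != 0 -> nonsingular_at g P.
  move=> ki Pk; apply: (@smooth_point _ _ _ _ _ U_(jl k)%MM
    (fun l => if l == i then lam k else 0%N)
    (fun l => if l == i then U_(jr k)%MM else U_(jl l)%MM)) => // [|l].
    by rewrite mevalXU.
  rewrite !msumU jlE //; case: eqVneq => [->|li].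
    by rewrite msumU jrE // addmC.
  by rewrite msumU jlE // mulm0n addm0.
(* Where N U_i is invertible, Bezout's relation u1 M = 1 + u2 N gives U_i as u1 (M U_i) - u2 (N
   U_i). *)
have caseB : P 0 (jl i) != 0 -> nonsingular_at g P.
  have M0 : (0 < M)%N by lia.
  have /(coprimeP _ M0) [[u1 u2] /= u12] : coprime M N by rewrite /coprime gcdnC copNM.
  have {}u12 : (u1 * M = 1 + u2 * N)%N by lia.
  move=> Pi; apply: (@smooth_point _ _ _ _ _ U_(jl i)%MM
    (fun l => if l == i then u2 else 0%N)
    (fun l => if l == i then (U_(jr i) *+ u1)%MM else U_(jl l)%MM)) => // [|l].
    by rewrite mevalXU.
  rewrite !msumU jliE; case: eqVneq => [->|li].
    rewrite msumMn msumU jriE; apply/mnmP => k; rewrite mnmDE !mulmnE !mnm1E.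
    by case: eqVneq; lia.
  by rewrite msumU jlE // mulm0n addm0.
have [j Pj] : exists j, P 0 j != 0.
  apply: contrapT => nex; case/eqP: P0; apply/rowP => j; rewrite mxE.
  by apply/eqP; apply: contraT => Pj; case: nex; exists j.
have [[k|k] jE] := io_surj j; have [ki|ki] := eqVneq k i.
- by apply: caseB; rewrite -ki /jl -jE.
- by apply: (caseA k ki); rewrite /jl -jE.
(* M (N U_i) = N (M U_i): the coordinates of the two axis generators vanish together. *)
- apply: caseB; have E : msum n (U_(jl i) *+ M)%MM = msum n (U_(jr i) *+ N)%MM.
    rewrite !msumMn !msumU jliE jriE; apply/mnmP => l; rewrite !mulmnE mnm1E; lia.
  have := XPE _ _ E; rewrite !evU => PE; apply: contraNneq Pj => Pi0.
  move: PE; rewrite Pi0 expr0n => /esym/eqP; have -> : (M == 0)%N = false by lia.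
  by rewrite expf_eq0 jE -ki => /andP [].
apply: caseB.
(* N times the slanted generator involves N U_i, so a nonzero slanted coordinate makes that of N U_i
   nonzero. *)
have E : msum n (U_(jr k) *+ N)%MM = msum n (U_(jl k) *+ (lam k * N) + U_(jl i))%MM.
  rewrite msumD !msumMn !msumU jliE jlE // jrE //.
  by apply/mnmP => l; rewrite !(mnmDE, mulmnE, mnm1E); lia.
have := XPE _ _ E; rewrite mevalXD mevalXU !evU => PE; apply: contraNneq Pj => Pi0.
move: PE; rewrite Pi0 mulr0 => /eqP; rewrite expf_eq0 => /andP [_].
by rewrite jE.
Qed.

End SufficiencyGeometry.

(** * The normalization map of the normal form *)

Section BasisNormalization.
Context (R : realType) (s p : nat) (g : 'I_p -> 'rV[int]_s) (n : 'I_p -> 'X_{1..s}).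
Context (B : 'M[int]_s) (Bu : B \in unitmx).
Local Notation C := R[i].
Local Notation K := {fraction {mpoly C[s]}}.
Local Notation S := (semigroup_generated_by (range g)).
Hypothesis SG : group_generated_by S = setT.
Hypothesis gE : forall j, g j = mrow (n j) *m B.
Hypothesis satE : forall m, saturation S m <-> forall k, 0 <= (m *m invmx B) 0 k.

Lemma gsum_row w : gsum (fun k => row k B) w = mrow w *m B.
Proof.
by rewrite gsum_mulmx; congr (_ *m _); apply/matrixP => k l; rewrite !mxE.
Qed.

Lemma saturation_rows : saturation S = semigroup_generated_by (range (fun k => row k B)).
Proof.
apply/seteqP; split=> m.
  move=> /satE m0; apply/generatedP; rewrite -[m](mulmxKV Bu) -(mrowK m0).
  by exists [multinom `|((m *m invmx B) 0%R k)|%N | k < s]; rewrite gsum_row.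
move=> /generatedP [w ->]; apply/satE => k.
by rewrite gsum_row mulmxK // mxE.
Qed.

(** The exponent map is injective as [B] is invertible, so the coefficients of a polynomial can be
    read off its image. *)
Lemma rows_param_inj : injective (toric_param R (fun k => row k B)).
Proof.
have coef m (P : {mpoly C[s]}) :
    lcoef (mrow m *m B) (toric_param R (fun k => row k B) P) = P@_m.
  have mem Q : semigroup_algebra (semigroup_generated_by (range (fun k => row k B)))
      (toric_param R (fun k => row k B) Q) by apply/semigroup_algebraP; exists Q.
  elim/mpolyind: P => [|c m' P _ _ IH]; first by rewrite rmorph0 lcoef0 mcoeff0.
  rewrite rmorphD (lcoefD _ (mem _) (mem _)) IH mcoeffD; congr (_ + _).
  rewrite -mul_mpolyC rmorphM toric_paramX /= mmapC.
  rewrite (lcoef_term (mrow m *m B) c) gsum_row mul_mpolyC mcoeffZ mcoeffX.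
  by rewrite (can_eq (mulmxK Bu)) (inj_eq (@mrow_inj s)).
by move=> P Q E; apply/mpolyP => m; rewrite -!coef E.
Qed.

(** [phi] sends t_k to the character of the k-th basis vector; its image is the algebra of the
    saturation, which is the integral closure. *)
Lemma normalization_map_of_basis : normalization_map S g (fun j => 'X_[n j] : {mpoly C[s]}).
Proof.
exists (toric_param R (fun k => row k B)); split.
- by move=> c; rewrite /toric_param /= mmapC.
- split=> [P _|P Q _ _|x].
  + rewrite normalized_saturation // saturation_rows.
    by apply/semigroup_algebraP; exists P.
  + exact: rows_param_inj.
  + rewrite normalized_saturation // saturation_rows => /semigroup_algebraP [P ->].
    by exists P.
by move=> j; rewrite toric_paramX gsum_row gE.
Qed.

End BasisNormalization.

Section BasisOfIsomorphism.
Context (s : nat) (i : 'I_s) (lam : 'I_s -> nat) (N M : nat).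
Hypothesis NM : (1 < N < M)%N.
Hypothesis copNM : gcdn N M = 1%N.
Local Notation NF := (normal_form i lam N M).
Local Notation T := (semigroup_generated_by [set mrow x | x in NF]).
Context (S : set 'rV[int]_s) (S0 : S 0) (SD : add_closed S).
Hypothesis SG : group_generated_by S = setT.

Lemma mulrnI_row (k : nat) (x y : 'rV[int]_s) : (0 < k)%N -> x *+ k = y *+ k -> x = y.
Proof.
move=> k0 E; apply/rowP => l; have := congr1 (fun v : 'rV[int]_s => v 0 l) E.
rewrite !mulmxnE -!(mulr_natr (_ 0 l)) => /mulIf; apply.
by rewrite pnatr_eq0 -lt0n.
Qed.

(** The isomorphism is additive on the semigroups only and has to be extended to Z^s. The inverse
    [pre] is defined at U_k for k <> i but U_i is missing from [T], so its image is made from those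
    of N U_i and M U_i. The matrix is invertible because [S] generates Z^s. *)
Lemma basis_of_isomorphism : semigroup_isomorphic S T ->
  exists2 B : 'M[int]_s, B \in unitmx & S = [set y *m B | y in T].
Proof.
move=> [phi [[phiT phi_inj phi_surj] phiD]].
have T0 : T 0 by apply: generated0.
have TD : add_closed T by apply: generatedD.
have /choice [pre preE] : forall y, exists x, T y -> S x /\ phi x = y.
  move=> y; have [/phi_surj [x Sx E]|nT] := pselect (T y); last by exists 0.
  by exists x.
have phiI x y : S x -> S y -> phi x = phi y -> x = y.
  by move=> Sx Sy; apply: phi_inj; rewrite in_setE.
have preD x y : T x -> T y -> pre (x + y) = pre x + pre y.
  move=> Tx Ty; have [Sx Ex] := preE x Tx; have [Sy Ey] := preE y Ty.
  have [Sxy Exy] := preE _ (TD _ _ Tx Ty).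
  by apply: phiI => //; [exact: SD|rewrite phiD // Exy Ex Ey].
have pre0 : pre 0 = 0.
  by have := preD 0 0 T0 T0; rewrite addr0 => /eqP; rewrite -subr_eq subrr eq_sym => /eqP.
have preMn x k : T x -> pre (x *+ k) = pre x *+ k.
  move=> Tx; elim: k => [|k IH]; first by rewrite !mulr0n.
  by rewrite !mulrS preD ?IH //; apply: semigroupMn.
have TNF x : NF x -> T (mrow x) by move=> nfx; apply: generated_mem; exists x.
have TU k : k != i -> T (mrow U_(k)%MM) by move=> ki; apply: TNF; apply: Or41; exists k.
have TN : T (mrow U_(i)%MM *+ N) by rewrite -mrowMn; apply: TNF; apply: Or43.
have TM : T (mrow U_(i)%MM *+ M) by rewrite -mrowMn; apply: TNF; apply: Or44.
have M0 : (0 < M)%N by lia.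
have N0 : (0 < N)%N by lia.
have /(coprimeP _ M0) [[u1 u2] /= u12] : coprime M N by rewrite /coprime gcdnC copNM.
have {}u12 : (u1 * M = u2 * N + 1)%N by lia.
pose a := pre (mrow U_(i)%MM *+ N); pose c := pre (mrow U_(i)%MM *+ M).
have acE : a *+ M = c *+ N.
  by rewrite -!preMn // -!mulrnA mulnC.
(* The image that U_i must have, since 1 = u1 M - u2 N. *)
pose bi := c *+ u1 - a *+ u2.
have biN : bi *+ N = a.
  rewrite mulrnBl -!mulrnA [(u1 * N)%N]mulnC mulrnA -acE -mulrnA [(M * u1)%N]mulnC u12.
  by rewrite mulrnDr addrC addKr.
have biM : bi *+ M = c.
  rewrite mulrnBl -!mulrnA u12 [(u2 * M)%N]mulnC [in X in _ - X]mulrnA acE -mulrnA.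
  by rewrite [(N * u2)%N]mulnC mulrnDr addrC addKr.
pose B := \matrix_k (if k == i then bi else pre (mrow U_(k)%MM)).
have UB k : mrow U_(k)%MM *m B = if k == i then bi else pre (mrow U_(k)%MM).
  have {1}-> : mrow U_(k)%MM = delta_mx 0 k.
    by apply/rowP => l; rewrite !mxE mnm1E eq_sym /=; case: (l == k).
  by rewrite -rowE rowK.
have preB y : T y -> pre y = y *m B.
  move=> Ty; suff [] : T y /\ pre y = y *m B by [].
  move: y Ty; apply: generated_min => [|x y [Tx Ex] [Ty Ey]|_ [x nfx <-]].
  - by rewrite pre0 mul0mx.
  - by split; [apply: TD|rewrite preD // Ex Ey mulmxDl].
  split; first exact: TNF.
  have nfxT := TNF x nfx; case: nfx nfxT => [[k ki ->]|[k ki ->]|->|->] nfxT.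
  - by rewrite UB (negPf ki).
  (* A slanted generator cannot be split inside [T], but its multiple by [N] can, and Z^s has no
     torsion. *)
  - apply: (mulrnI_row N0); rewrite -preMn // mrowD mrowMn mulrnDl -mulrnA.
    have TkN : T (mrow U_(k)%MM *+ (lam k * N)) by apply: semigroupMn => //; apply: TU.
    rewrite preD // preMn; last exact: TU.
    rewrite mulmxDl mulrn_mulmx !UB eqxx (negPf ki) mulrnDl -mulrnA.
    by rewrite biN.
  - by rewrite mrowMn mulrn_mulmx UB eqxx biN.
  - by rewrite mrowMn mulrn_mulmx UB eqxx biM.
have SE : S = [set y *m B | y in T].
  apply/seteqP; split=> [x Sx|_ [y Ty <-]]; last by rewrite -preB //; case: (preE y Ty).
  have Tx := phiT x Sx; exists (phi x) => //; rewrite -preB //.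
  by have [? ?] := preE _ Tx; apply: phiI.
exists B => //.
have span (m : 'rV[int]_s) : exists w : 'rV[int]_s, m = w *m B.
  have [u [v [+ + ->]]] := group_generated_diff m S0 SD SG.
  by rewrite {1 2}SE => -[y _ <-] [z _ <-]; exists (y - z); rewrite mulmxBl.
have /choice [w wE] := fun k => span (delta_mx 0 k).
suff /mulmx1_unit [] : \matrix_k w k *m B = 1%:M by [].
by apply/row_matrixP => k; rewrite row_mul rowK -wE rowE mulmx1.
Qed.

End BasisOfIsomorphism.

Lemma isolated_normalization_of_normal_form (R : realType) (s : nat)
    (S : set 'rV[int]_s.+1) (g : 'I_(2 * s.+1) -> 'rV[int]_s.+1)
    (lambda : nat -> nat) (N M : nat) :
  S = semigroup_generated_by (range g) -> group_generated_by S = setT ->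
  (forall k, (1 <= k < s.+1)%N -> (0 < lambda k)%N) -> (1 < N < M)%N -> gcdn N M = 1%N ->
  semigroup_isomorphic S
    (semigroup_generated_by (normal_form_generators s.+1 lambda N M)) ->
  isolated_singularity_at_origin R g /\
  exists f : 'I_(2 * s.+1) -> {mpoly R[i][s.+1]}, normalization_map S g f.
Proof.
move=> SE SG lambda0 NM cop; rewrite normal_form_generatorsE.
set lam := (fun k : 'I_s.+1 => lambda k.+1); set i := (ord_max : 'I_s.+1).
set T := semigroup_generated_by _ => iso.
have S0 : S 0 by rewrite SE; apply: generated0.
have SD : add_closed S by rewrite SE; apply: generatedD.
have lam0 k : k != i -> (0 < lam k)%N.
  move=> ki; suff ks : (k < s)%N by apply: lambda0; rewrite ltnS.
  rewrite ltn_neqAle -ltnS ltn_ord andbT.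
  by apply: contraNneq ki => E; apply/eqP/val_inj.
have [B Bu SB] := basis_of_isomorphism NM cop S0 SD SG iso.
have iBu : invmx B \in unitmx by rewrite unitmx_inv.
have Tpos y : T y -> forall k, 0 <= y 0 k.
  move: y; apply: generated_min => [k|x y x0 y0 k|_ [x _ <-] k]; rewrite mxE //.
  by rewrite addr_ge0.
have ST m : S m <-> T (m *m invmx B).
  rewrite {1}SB; split=> [[y Ty <-]|Tm]; first by rewrite mulmxK.
  by exists (m *m invmx B); rewrite ?mulmxKV.
have gS j : S (g j) by rewrite SE; apply: generated_mem; exists j.
pose n j := [multinom absz ((g j *m invmx B) 0%R k) | k < s.+1].
have nE j : mrow (n j) = g j *m invmx B by apply/mrowK/Tpos/ST.
have gE : (fun j => mrow (n j)) = (fun j => g j *m invmx B).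
  by apply/funext => j; rewrite nE.
have NFS : normal_form i lam N M `<=` in_semigroup n.
  move=> x nfx; have : S (mrow x *m B) by apply/ST; rewrite mulmxK //; apply: generated_mem; exists x.
  rewrite SE => /generatedP [b bE]; exists b; apply: mrow_inj.
  by rewrite -gsum_mrow gE gsum_mul -bE mulmxK.
have gensT j : T (mrow (n j)) by rewrite nE; apply/ST.
split.
  rewrite -(isolated_singularity_unitmx R g iBu) -gE.
  exact: (isolated_of_normal_form R lam0 NM cop NFS gensT).
exists (fun j => 'X_[n j]); rewrite SE.
apply: (normalization_map_of_basis R Bu); rewrite -?SE //.
  by move=> j; rewrite nE mulmxKV.
move=> m; split=> [[q q0 /ST/Tpos m0] k|m0].
  by have := m0 k; rewrite mulrn_mulmx mulmxnE pmulrn_lge0.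
have satD : add_closed (saturation S) by apply: saturationD.
have sat0 : saturation S 0 by exists 1%N.
rewrite -[m](mulmxKV Bu) -(mrowK m0) -gsum_row.
apply: (big_ind (saturation S)) => // k _; apply: semigroupMn => //.
have TNF x : normal_form i lam N M x -> T (mrow x) by move=> nfx; apply: generated_mem; exists x.
have -> : row k B = mrow U_(k)%MM *m B.
  by rewrite -gsum_row gsumU.
(* U_i is reached only through its multiple N U_i; the other U_k are in the semigroup itself. *)
have [->|ki] := eqVneq k i.
  exists N; first by lia.
  by apply/ST; rewrite -mulrn_mulmx mulmxK // -mrowMn; apply: TNF; apply: Or43.
apply: saturation_sub; apply/ST; rewrite mulmxK //.
by apply: TNF; apply: Or41; exists k.
Qed.

Lemma normal_form_generators2 (lambda : nat -> nat) (N M : nat) :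
  normal_form_generators 2 lambda N M =
  [set vec2 1 0; vec2 (lambda 1%N)%:Z 1; vec2 0 N%:Z; vec2 0 M%:Z].
Proof.
have e1 : e_ 2 1 = vec2 1 0 by apply/rowP => -[[|[|]]//= ?]; rewrite !mxE.
have e2 k : e_ 2 2 *+ k = vec2 0 k%:Z.
  by apply/rowP => -[[|[|]]//= ?]; rewrite mulmxnE !mxE /= ?mulr0n ?mul0rn ?natz ?add0r ?addr0.
have el k : e_ 2 1 *+ k + e_ 2 2 = vec2 k%:Z 1.
  by apply/rowP => -[[|[|]]//= ?]; rewrite !mxE mulmxnE !mxE /= ?mulr0n ?mul0rn ?natz ?add0r ?addr0.
rewrite /normal_form_generators; apply/seteqP; split=> x.
  case=> [[[[|[|k]]//= _ <-]|[[|[|k]]//= _ <-]]|[->|->]]; rewrite ?el ?e2 ?e1.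
  - by left; left; left.
  - by left; left; right.
  - by left; right.
  - by right.
case=> [[[->|->]|->]|->]; rewrite -?e1 -?e2 -?el.
- by left; left; exists 1%N.
- by left; right; exists 1%N.
- by right; left.
- by right; right.
Qed.

Theorem theorem3p6 (R : realType) :
  (forall (s : nat) (S : set 'rV[int]_s) (g : 'I_(2 * s) -> 'rV[int]_s),
     (0 < s)%N ->
     toric_semigroup R S ->
     S = semigroup_generated_by (range g) ->
     (isolated_singularity_at_origin R g /\
      (exists f : 'I_(2 * s) -> {mpoly R[i][s]}, normalization_map S g f))
     <->
     (exists (lambda : nat -> nat) (n m : nat),
        [/\ forall i, (1 <= i < s)%N -> (0 < lambda i)%N,
            (1 < n < m)%N,
            gcdn n m = 1%N &
            semigroup_isomorphic S
              (semigroup_generated_by (normal_form_generators s lambda n m))]))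
  /\
  (forall (S : set 'rV[int]_2) (g : 'I_(2 * 2) -> 'rV[int]_2),
     toric_semigroup R S ->
     S = semigroup_generated_by (range g) ->
     (isolated_singularity_at_origin R g /\
      (exists f : 'I_(2 * 2) -> {mpoly R[i][2]}, normalization_map S g f))
     <->
     (exists (lambda n m : nat),
        [/\ (0 < lambda)%N,
            (1 < n < m)%N,
            gcdn n m = 1%N &
            semigroup_isomorphic S
              (semigroup_generated_by
                 [set vec2 1 0; vec2 lambda%:Z 1;
                      vec2 0 n%:Z; vec2 0 m%:Z])])).
Proof.
have main s (S : set 'rV[int]_s) (g : 'I_(2 * s) -> 'rV[int]_s) : (0 < s)%N ->
    toric_semigroup R S -> S = semigroup_generated_by (range g) ->
    (isolated_singularity_at_origin R g /\
      (exists f : 'I_(2 * s) -> {mpoly R[i][s]}, normalization_map S g f)) <->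
    (exists (lambda : nat -> nat) (n m : nat),
        [/\ forall i, (1 <= i < s)%N -> (0 < lambda i)%N, (1 < n < m)%N, gcdn n m = 1%N &
            semigroup_isomorphic S
              (semigroup_generated_by (normal_form_generators s lambda n m))]).
  case: s S g => // s S g _ [SG _ _] SE; split=> [[iso [f nf]]|].
    exact: normal_form_of_isolated iso nf.
  move=> [lambda [n [m [lambda0 nm cop iso]]]].
  exact: isolated_normalization_of_normal_form iso.
split=> [|S g TS SE]; first exact: main.
rewrite (main 2%N S g isT TS SE); split=> [[lambda [n [m [lambda0 nm cop iso]]]]|].
  exists (lambda 1%N), n, m; split=> //; first exact: lambda0.
  by rewrite -normal_form_generators2.
move=> [lambda [n [m [lambda0 nm cop iso]]]].
(* For s = 2 only the value at 1 enters, so a constant function serves. *)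
exists (fun=> lambda), n, m; split=> //.
by rewrite normal_form_generators2.
Qed.
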